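(* Let $\Gamma$ be a discrete group with the Haagerup property, let $\theta\in\mathrm{Aut}(\Gamma)$ be an automorphism, and let $k\ge 2$, $r\ge 1$ be integers. Then the twisted wreath product $\Gamma\wr^{\theta}_{\mathbf{Q}_k(0,r)}V_{k,r}$ associated to $\theta$ and to the usual action $V_{k,r}\curvearrowright\mathbf{Q}_k(0,r)$ has the Haagerup property.
   Context: A discrete group $G$ has the Haagerup property if there is a net of positive definite functions on $G$, each vanishing at infinity (for every $\varepsilon>0$ only finitely many group elements have value of modulus $\ge\varepsilon$), converging pointwise to $1$. Higman–Thompson group $V_{k,r}$: a standard $k$-adic interval of $[0,r)$ is an interval $[\frac{a}{k^n},\frac{a+1}{k^n})$ with $n\ge0$, $0\le a\le rk^n-1$. $V_{k,r}$ is the group of bijections $v$ of $[0,r)$ for which there are two finite partitions $\{I_1,\dots,I_n\}$ and $\{J_1,\dots,J_n\}$ of $[0,r)$ into standard $k$-adic intervals and a permutation $\pi$ such that $v$ restricts to the increasing affine bijection $I_i\to J_{\pi(i)}$ for all $i$. (Equivalently, it is described by pairs of $k$-ary forests with $r$ roots and the same number of leaves, together with a bijection of the leaves.) $\mathbf{Q}_k(0,r)$ is the set of $k$-adic rationals (elements of $\mathbf{Z}[1/k]$) in $[0,r)$; it is $V_{k,r}$-invariant. $v'$ denotes the right-derivative, which takes values in the powers of $k$. $\bigoplus_{\mathbf{Q}_k(0,r)}\Gamma$ is the group of finitely supported maps $\mathbf{Q}_k(0,r)\to\Gamma$. $V_{k,r}$ acts on it by $$(v\cdot a)(x)=\theta^{\log_k(v'(v^{-1}x))}\big(a(v^{-1}x)\big),$$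 and $\Gamma\wr^{\theta}_{\mathbf{Q}_k(0,r)}V_{k,r}:=\big(\bigoplus_{\mathbf{Q}_k(0,r)}\Gamma\big)\rtimes V_{k,r}$ is the corresponding semidirect product. *)

(* Defs.v *)
From HB Require Import structures.
From mathcomp Require Import all_boot all_order all_algebra.
From mathcomp Require Import perm finmap complex.
From mathcomp Require Import boolp classical_sets functions cardinality.
From mathcomp Require Import reals topology normedtype.
From mathcomp Require Import ring.

Set Implicit Arguments.
Unset Strict Implicit.
Unset Printing Implicit Defensive.

Import Order.TTheory GRing.Theory Num.Theory.
Import numFieldNormedType.Exports.

Local Open Scope classical_set_scope.
Local Open Scope ring_scope.

Section HaagerupProperty.
Variable R : realType.

(* In [R[i]], [0 <= z] means that [z] is real and nonnegative. *)
Definition positive_definite (G : groupType) (phi : G -> R[i]) : Prop :=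
  forall (n : nat) (c : 'I_n -> R[i]) (g : 'I_n -> G),
    0 <= \sum_(i < n) \sum_(j < n) (c i)^* * c j * phi ((g i)^-1 * g j)%g.

Definition vanishes_at_infinity (G : groupType) (phi : G -> R[i]) : Prop :=
  forall eps : R, 0 < eps -> finite_set [set g | eps%:C%C <= `|phi g|].

Definition directed (I : Type) (le : I -> I -> Prop) : Prop :=
  [/\ inhabited I, forall i, le i i,
      forall i j l, le i j -> le j l -> le i l
    & forall i j, exists l, le i l /\ le j l].

Definition net_cvg (I : Type) (le : I -> I -> Prop) (u : I -> R[i]) (z : R[i])
    : Prop :=
  forall eps : R, 0 < eps ->
    exists i0, forall i, le i0 i -> `|u i - z| < eps%:C%C.

Definition haagerup (G : groupType) : Prop :=
  exists (I : Type) (le : I -> I -> Prop) (phi : I -> G -> R[i]),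
  [/\ directed le,
      forall i, positive_definite (phi i),
      forall i, vanishes_at_infinity (phi i)
    & forall g, net_cvg le (phi ^~ g) 1].

End HaagerupProperty.


Definition expgz (G : groupType) (x : G) (m : int) : G :=
  match m with Posz n => x ^+ n | Negz n => x ^- n.+1 end%g.

Lemma expgzD (G : groupType) (x : G) (m n : int) :
  expgz x (m + n) = (expgz x m * expgz x n)%g.
Proof.
have subE (p q : nat) : expgz x (p%:Z - q%:Z) = (x ^+ p / x ^+ q)%g.
  case: (leqP q p) => [qp|pq].
    by rewrite subzn// -expgnFr.
  have -> : p%:Z - q%:Z = Negz (q - p).-1.
    by rewrite NegzE prednK ?subn_gt0// -subzn 1?ltnW// opprB.
  rewrite /= prednK ?subn_gt0// expgnFr 1?ltnW// invgM invgK.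
  by [].
have repr (u : int) : exists p q : nat, u = p%:Z - q%:Z.
  by case: u => u; [exists u, 0%N|exists 0%N, u.+1]; rewrite ?subr0// sub0r NegzE.
have [p [q ->]] := repr m; have [p' [q' ->]] := repr n.
rewrite addrACA -opprD -!PoszD !subE.
have cx (i j : nat) : (x ^+ i * x ^+ j)%g = (x ^+ j * x ^+ i)%g.
  by rewrite -!expgnDr addnC.
have cV (i j : nat) : ((x ^+ i)^-1 * x ^+ j)%g = (x ^+ j * (x ^+ i)^-1)%g.
  by apply: (@mulgI _ (x ^+ i)%g); rewrite mulgA mulgV mul1g mulgA cx mulgK.
by rewrite !expgnDr invgM -!mulgA; congr (_ * _)%g; rewrite [in RHS]mulgA cV -!mulgA -!invgM cx.
Qed.

Section SelfBijections.
Variable X : choiceType.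

(* As a group: [(f * g) x = f (g x)]; functions act on the left. *)
Record selfbij := Selfbij {
  selfbij_fun :> X -> X;
  _ : `[< bijective selfbij_fun >] }.

HB.instance Definition _ := [isSub for selfbij_fun].
HB.instance Definition _ := [Choice of selfbij by <:].

Lemma selfbijP (f : selfbij) : bijective f.
Proof. by apply/asboolP; case: f. Qed.

Lemma selfbij_ext (f g : selfbij) : f =1 g -> f = g.
Proof. by move=> fg; apply/val_inj/funext. Qed.

Definition mk_selfbij (f : X -> X) (fP : bijective f) : selfbij :=
  Selfbij (asboolT fP).

Definition selfbij_one : selfbij := mk_selfbij (Bijective (frefl id) (frefl id)).

Definition selfbij_mul (f g : selfbij) : selfbij :=
  mk_selfbij (bij_comp (selfbijP f) (selfbijP g)).

Lemma selfbij_inv_subproof (f : selfbij) :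
  {g : selfbij | cancel f g /\ cancel g f}.
Proof.
apply: cid; have [g fK gK] := selfbijP f.
by exists (mk_selfbij (Bijective gK fK)).
Qed.

Definition selfbij_inv (f : selfbij) : selfbij := sval (selfbij_inv_subproof f).

Lemma selfbij_mulA : associative selfbij_mul.
Proof. by move=> f g h; apply: selfbij_ext. Qed.
Lemma selfbij_mul1 : left_id selfbij_one selfbij_mul.
Proof. by move=> f; apply: selfbij_ext. Qed.
Lemma selfbij_1mul : right_id selfbij_one selfbij_mul.
Proof. by move=> f; apply: selfbij_ext. Qed.
Lemma selfbij_mulV : left_inverse selfbij_one selfbij_inv selfbij_mul.
Proof.
move=> f; apply: selfbij_ext => x /=.
by have [fK _] := svalP (selfbij_inv_subproof f); exact: fK.
Qed.
Lemma selfbij_Vmul : right_inverse selfbij_one selfbij_inv selfbij_mul.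
Proof.
move=> f; apply: selfbij_ext => x /=.
by have [_ fK] := svalP (selfbij_inv_subproof f); exact: fK.
Qed.

HB.instance Definition _ := isGroup.Build selfbij
  selfbij_mulA selfbij_mul1 selfbij_1mul selfbij_mulV selfbij_Vmul.

Lemma selfbijM (f g : selfbij) x : (f * g)%g x = f (g x). Proof. by []. Qed.
Lemma selfbij1 x : (1%g : selfbij) x = x. Proof. by []. Qed.
Lemma selfbijK (f : selfbij) : cancel f (f^-1)%g.
Proof. by move=> x; rewrite -selfbijM mulVg. Qed.
Lemma selfbijVK (f : selfbij) : cancel (f^-1)%g f.
Proof. by move=> x; rewrite -selfbijM mulgV. Qed.

End SelfBijections.

Section Automorphisms.
Variable G : groupType.

Definition is_automorphism (f : selfbij G) : Prop :=
  {morph f : x y / (x * y)%g}.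

Record autG := AutG {
  autG_bij :> selfbij G;
  _ : `[< is_automorphism autG_bij >] }.

HB.instance Definition _ := [isSub for autG_bij].
HB.instance Definition _ := [Choice of autG by <:].

Lemma automorphism_closed :
  group_closed (fun f : selfbij G => `[< is_automorphism f >]).
Proof.
split; first by apply/asboolP.
move=> f g /asboolP fM /asboolP gM; apply/asboolP => x y.
rewrite !selfbijM -fM; congr (f _); apply: (can_inj (selfbijK g)).
by rewrite gM !selfbijVK.
Qed.

HB.instance Definition _ := SubChoice_isSubGroup.Build (selfbij G) _ autG
  automorphism_closed.

Lemma autG_morph (f : autG) : {morph f : x y / (x * y)%g}.
Proof. by apply/asboolP; case: f. Qed.
Lemma autG_ext (f g : autG) : f =1 g -> f = g.
Proof. by move=> fg; apply/val_inj/selfbij_ext. Qed.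
Lemma autGM (f g : autG) x : (f * g)%g x = f (g x). Proof. by []. Qed.
Lemma autG1 x : (1%g : autG) x = x. Proof. by []. Qed.
Lemma autG_fix1 (f : autG) : f 1%g = 1%g.
Proof. by apply: (@mulgI _ (f 1%g)); rewrite -autG_morph !mulg1. Qed.

Definition mk_autG (f : G -> G) (fb : bijective f)
    (fM : {morph f : x y / (x * y)%g}) : autG :=
  AutG (asboolT (fM : is_automorphism (mk_selfbij fb))).

End Automorphisms.

Section SemidirectProduct.
Variables (N H : groupType) (al : {multiplicative H -> autG N}).

(* The product is [(a, v) (b, w) = (a (v . b), v w)], see [sd_mul]. *)
Definition semidirect of {multiplicative H -> autG N} : Type := (N * H)%type.
Local Notation sdT := (semidirect al).

HB.instance Definition _ := Choice.on sdT.

Definition sd_one : sdT := (1%g, 1%g).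
Definition sd_mul (x y : sdT) : sdT := (x.1 * al x.2 y.1, x.2 * y.2)%g.
Definition sd_inv (x : sdT) : sdT := (al x.2^-1 x.1^-1, x.2^-1)%g.

Lemma sd_al1 : al 1%g = 1%g.
Proof. by apply: (@mulgI _ (al 1%g)); rewrite -gmulfM !mulg1. Qed.

Lemma sd_mulA : associative sd_mul.
Proof.
by move=> x y z; congr pair; rewrite /= ?mulgA// autG_morph gmulfM autGM mulgA.
Qed.
Lemma sd_mul1 : left_id sd_one sd_mul.
Proof. by case=> a v; rewrite /sd_mul /= sd_al1 autG1 !mul1g. Qed.
Lemma sd_1mul : right_id sd_one sd_mul.
Proof. by case=> a v; rewrite /sd_mul /= autG_fix1 !mulg1. Qed.
Lemma sd_mulV : left_inverse sd_one sd_inv sd_mul.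
Proof. by case=> a v; rewrite /sd_mul /= -autG_morph !mulVg autG_fix1. Qed.
Lemma sd_Vmul : right_inverse sd_one sd_inv sd_mul.
Proof.
by case=> a v; rewrite /sd_mul /= -autGM -gmulfM !mulgV sd_al1 autG1 mulgV.
Qed.

HB.instance Definition _ := isGroup.Build sdT
  sd_mulA sd_mul1 sd_1mul sd_mulV sd_Vmul.

End SemidirectProduct.

Section DirectSum.
Variables (X : choiceType) (G : groupType).

Definition direct_sum := {fsfun X -> G with 1%g}.

HB.instance Definition _ := Choice.on direct_sum.

Local Open Scope fset_scope.

Definition dsum_one : direct_sum := [fsfun].
Definition dsum_mul (a b : direct_sum) : direct_sum :=
  [fsfun x in finsupp a `|` finsupp b => (a x * b x)%g].
Definition dsum_inv (a : direct_sum) : direct_sum :=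
  [fsfun x in finsupp a => (a x)^-1%g].

Lemma dsum_ext (a b : direct_sum) : a =1 b -> a = b.
Proof. by move=> ab; apply/fsfunP. Qed.
Lemma dsum_out (a : direct_sum) x : x \notin finsupp a -> a x = 1%g.
Proof. exact: fsfun_dflt. Qed.
Lemma dsum_oneE x : dsum_one x = 1%g.
Proof. by rewrite /dsum_one fsfun0E. Qed.
Lemma dsum_mulE (a b : direct_sum) x : dsum_mul a b x = (a x * b x)%g.
Proof.
rewrite /dsum_mul fsfunE inE; case: ifPn => //.
by rewrite negb_or => /andP[xa xb]; rewrite !dsum_out// mulg1.
Qed.
Lemma dsum_invE (a : direct_sum) x : dsum_inv a x = (a x)^-1%g.
Proof.
rewrite /dsum_inv fsfunE; case: ifPn => // xa.
by rewrite dsum_out// invg1.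
Qed.

Lemma dsum_mulA : associative dsum_mul.
Proof. by move=> a b c; apply: dsum_ext => x; rewrite !dsum_mulE mulgA. Qed.
Lemma dsum_mul1 : left_id dsum_one dsum_mul.
Proof. by move=> a; apply: dsum_ext => x; rewrite dsum_mulE dsum_oneE mul1g. Qed.
Lemma dsum_1mul : right_id dsum_one dsum_mul.
Proof. by move=> a; apply: dsum_ext => x; rewrite dsum_mulE dsum_oneE mulg1. Qed.
Lemma dsum_mulV : left_inverse dsum_one dsum_inv dsum_mul.
Proof.
by move=> a; apply: dsum_ext => x; rewrite dsum_mulE dsum_invE mulVg dsum_oneE.
Qed.
Lemma dsum_Vmul : right_inverse dsum_one dsum_inv dsum_mul.
Proof.
by move=> a; apply: dsum_ext => x; rewrite dsum_mulE dsum_invE mulgV dsum_oneE.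
Qed.

HB.instance Definition _ := isGroup.Build direct_sum
  dsum_mulA dsum_mul1 dsum_1mul dsum_mulV dsum_Vmul.

Lemma dsumM (a b : direct_sum) x : (a * b)%g x = (a x * b x)%g.
Proof. exact: dsum_mulE. Qed.

End DirectSum.

Section HigmanThompson.
Variables (R : realType) (k r : nat).

(* The elements are the points of [0, r) *)
Record hoitv := Hoitv {
  hoitv_val :> R;
  _ : 0 <= hoitv_val < r%:R }.

HB.instance Definition _ := [isSub for hoitv_val].
HB.instance Definition _ := [Choice of hoitv by <:].

(* The pair [p = (n, a)] encodes the interval [a / k ^ n, (a + 1) / k ^ n);
   it is a standard k-adic interval of [0, r) when [kstd p] holds. *)
Definition kstd (p : nat * nat) : bool := (p.2 < r * k ^ p.1)%N.
Definition klo (p : nat * nat) : R := p.2%:R / k%:R ^+ p.1.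
Definition khi (p : nat * nat) : R := p.2.+1%:R / k%:R ^+ p.1.
Definition kitv (p : nat * nat) : set R := `[klo p, khi p[.

Definition kpartition (N : nat) (I : 'I_N -> nat * nat) : Prop :=
  (forall i, kstd (I i)) /\
  partition [set: 'I_N] (fun i => kitv (I i)) `[0, r%:R[.

(* The increasing affine bijection [kitv p] -> [kitv q] *)
Definition kaffine (p q : nat * nat) (x : R) : R :=
  klo q + (khi q - klo q) / (khi p - klo p) * (x - klo p).

Definition is_higman_thompson (v : selfbij hoitv) : Prop :=
  exists (N : nat) (I J : 'I_N -> nat * nat) (s : 'S_N),
  [/\ kpartition I, kpartition J &
      forall (i : 'I_N) (x : hoitv), kitv (I i) x ->
        v x = kaffine (I i) (J (s i)) x :> R].

(* [v] extended to [R] by the identity outside [0, r); the extension does not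
   affect right derivatives at points of [0, r). *)
Definition hoext (v : hoitv -> hoitv) (y : R) : R :=
  if insub y is Some x then hoitv_val (v x) else y.

End HigmanThompson.

Definition right_derivative (R : realType) (f : R -> R) (x : R) : R :=
  lim (h^-1 * (f (x + h) - f x) @[h --> 0^'+]).

(* Elements of Z[1/k] *)
Definition is_kadic (R : realType) (k : nat) (x : R) : Prop :=
  exists (a : int) (n : nat), x = a%:~R / k%:R ^+ n.

(* Only meaningful when [1 < k] and [y] is an integer power of [k], which is the
   case of the right derivatives below (see [logk_exp]). *)
Definition logk (R : realType) (k : nat) (y : R) : int :=
  xget 0 [set m : int | k%:R ^ m = y].

Section HigmanThompsonTheory.
Variables (R : realType) (k r : nat) (hk : (1 < k)%N).
Local Notation K := (k%:R : R).
Local Notation hoitv := (hoitv R r).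
Local Notation klo := (@klo R k).
Local Notation khi := (@khi R k).
Local Notation kitv := (@kitv R k).
Local Notation kaffine := (@kaffine R k).
Local Notation kstd := (kstd k r).

Let K_gt0 : 0 < K. Proof. by rewrite ltr0n ltnW. Qed.
Let Kn_gt0 n : 0 < K ^+ n. Proof. by rewrite exprn_gt0. Qed.
Let Kn_neq0 n : K ^+ n != 0. Proof. by rewrite gt_eqF. Qed.

Lemma kitvE p x :
  kitv p x <-> p.2%:R <= x * K ^+ p.1 < p.2.+1%:R.
Proof.
rewrite /kitv /klo /khi /= in_itv /= ler_pdivrMr// ltr_pdivlMr//.
Qed.

Lemma klo_in p : kitv p (klo p).
Proof. by apply/kitvE; rewrite /klo divfK// lexx ltr_nat /=. Qed.

Lemma kwidth p : khi p - klo p = (K ^+ p.1)^-1.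
Proof. by rewrite /khi /klo -mulrBl -natrB// subSnn mul1r. Qed.

Lemma kaffineE p q x :
  kaffine p q x = klo q + K ^+ p.1 / K ^+ q.1 * (x - klo p).
Proof. by rewrite /kaffine !kwidth invrK [_^-1 * _]mulrC. Qed.

Lemma kaffine_scale p q x :
  kaffine p q x * K ^+ q.1 - q.2%:R = x * K ^+ p.1 - p.2%:R.
Proof.
rewrite kaffineE mulrDl /klo divfK// addrAC subrr add0r.
rewrite mulrAC divfK// mulrBr [K ^+ _ * (_ / _)]mulrC divfK//.
by rewrite [x * _]mulrC.
Qed.

Lemma kaffine_uniq p q x y :
  y * K ^+ q.1 - q.2%:R = x * K ^+ p.1 - p.2%:R -> y = kaffine p q x.
Proof.
rewrite -(kaffine_scale p q x) => /addIr; exact: mulIf.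
Qed.

Lemma kaffine_in p q x : kitv p x -> kitv q (kaffine p q x).
Proof.
move=> /kitvE; rewrite -!natr1 => xp; apply/kitvE; rewrite -!natr1.
move: xp; have := kaffine_scale p q x.
move: (kaffine _ _ _ * _) (x * _) => u v uv /andP[h1 h2].
rewrite -subr_ge0 uv subr_ge0 h1 /= addrC -ltrBlDr uv ltrBlDr.
by rewrite addrC.
Qed.

Lemma kaffineK p q x : kaffine q p (kaffine p q x) = x.
Proof. by symmetry; apply: kaffine_uniq; rewrite kaffine_scale. Qed.

Lemma kaffine_comp p q s x : kaffine q s (kaffine p q x) = kaffine p s x.
Proof. by apply: kaffine_uniq; rewrite !kaffine_scale. Qed.

Lemma kitv_hoitv p x : kstd p -> kitv p x -> 0 <= x < r%:R.
Proof.
move=> ps /kitvE/andP[h1 h2]; apply/andP; split.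
  by rewrite -(pmulr_lge0 _ (Kn_gt0 p.1)) (le_trans _ h1).
rewrite -(ltr_pM2r (Kn_gt0 p.1)) (lt_le_trans h2)//.
by rewrite -natrX -natrM ler_nat.
Qed.

Lemma kitv_depth p q x : kitv p x -> kitv q x -> p.1 = q.1 -> p = q.
Proof.
case: p q => [n a] [m b] /kitvE/= /andP[h1 h2] /kitvE/= /andP[h3 h4] e.
rewrite -e in h3 h4 *; congr pair.
have := le_lt_trans h1 h4; have := le_lt_trans h3 h2.
by rewrite !ltr_nat !ltnS => ba ab; apply/eqP; rewrite eqn_leq ab.
Qed.

Lemma kitv_ex (x : hoitv) n : exists p, [/\ p.1 = n, kstd p & kitv p x].
Proof.
case: x => x /= /andP[x0 xr].
have y0 : 0 <= x * K ^+ n by rewrite mulr_ge0// ltW.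
have := truncn_itv y0 => h.
exists (n, Num.truncn (x * K ^+ n)); split=> //; last exact/kitvE.
rewrite /kstd /=; case/andP: h => h _.
rewrite -(ltr_nat R) (le_lt_trans h)// natrM natrX ltr_pM2r//.
Qed.

Lemma hoitv_of p x : kstd p -> kitv p x -> exists y : hoitv, y = x :> R.
Proof. by move=> ps px; exists (Hoitv (kitv_hoitv ps px)). Qed.

Let ksub (p s : nat * nat) : nat * nat := (p.1 + s.1, p.2 * k ^ s.1 + s.2)%N.

Lemma kstd_sub p s : (s.2 < k ^ s.1)%N -> kstd p -> kstd (ksub p s).
Proof.
rewrite /kstd /= => h1 h2; rewrite expnD mulnA.
apply: leq_trans (_ : p.2.+1 * k ^ s.1 <= _)%N; last by rewrite leq_mul2r h2 orbT.
by rewrite mulSn addnC ltn_add2r.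
Qed.

Lemma kitv_sub p s x : (s.2 < k ^ s.1)%N -> kitv (ksub p s) x -> kitv p x.
Proof.
move=> h1 /kitvE/=; rewrite exprD mulrA => /andP[h2 h3]; apply/kitvE.
rewrite -(ler_pM2r (Kn_gt0 s.1)) -[_ < _](ltr_pM2r (Kn_gt0 s.1)).
rewrite (le_trans _ h2) ?(lt_le_trans h3)//; rewrite -natrX -natrM ler_nat.
  by rewrite mulSn addnC ltn_add2r.
by rewrite leq_addr.
Qed.

Lemma kaffine_sub p q s : kaffine (ksub p s) (ksub q s) =1 kaffine p q.
Proof.
move=> x; symmetry; apply: kaffine_uniq => /=.
have := kaffine_scale p q x; move: (kaffine _ _ _) => y e.
have: (y * K ^+ q.1 - q.2%:R) * K ^+ s.1 = (x * K ^+ p.1 - p.2%:R) * K ^+ s.1.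
  by rewrite e.
rewrite !mulrBl !exprD !natrD !natrM !natrX !mulrA => {}e.
by rewrite !opprD !addrA e.
Qed.

Lemma ksub_ex p n : (n <= p.1)%N -> kstd p ->
  exists q s, [/\ q.1 = n, (s.2 < k ^ s.1)%N, s.1 = (p.1 - n)%N, kstd q & p = ksub q s].
Proof.
move=> np ps; have k0 : (0 < k)%N by apply: ltnW.
exists (n, p.2 %/ k ^ (p.1 - n))%N, (p.1 - n, p.2 %% k ^ (p.1 - n))%N.
split => //=; first by rewrite ltn_mod expn_gt0 k0.
  by rewrite /kstd /= ltn_divLR ?expn_gt0 ?k0// -mulnA -expnD subnKC.
by rewrite /ksub /= subnKC// -divn_eq; case: (p).
Qed.

Let aff_on (v : hoitv -> hoitv) (p q : nat * nat) : Prop :=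
  forall x : hoitv, kitv p x -> v x = kaffine p q x :> R.

Let deep (v : hoitv -> hoitv) (n : nat) : Prop :=
  forall p, kstd p -> (n <= p.1)%N -> exists2 q, kstd q & aff_on v p q.

Let aff_sub v p q s : (s.2 < k ^ s.1)%N -> aff_on v p q ->
  aff_on v (ksub p s) (ksub q s).
Proof. by move=> h vpq x /(kitv_sub h) /vpq ->; rewrite kaffine_sub. Qed.

Lemma ht_deep v : is_higman_thompson k v -> exists n, deep v n.
Proof.
move=> [N [I [J [s [[Is [Icov _ _]] [Js _] vE]]]]].
exists (\max_(i < N) (I i).1)%N => p ps pn.
have: `[0, r%:R[%classic (klo p).
  by rewrite /= in_itv /=; apply: kitv_hoitv ps (klo_in p).
rewrite -Icov => -[i _ Ii].
have Ip : ((I i).1 <= p.1)%N by apply: leq_trans pn; exact: leq_bigmax.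
have [q [t [qn tk _ qs pE]]] := ksub_ex Ip ps.
have qI : q = I i.
  apply: (@kitv_depth _ _ (klo p)) => //.
  by apply: (@kitv_sub q t) => //; rewrite -pE; apply: klo_in.
exists (ksub (J (s i)) t); first exact: kstd_sub.
by rewrite pE qI; apply: aff_sub => // x; apply: vE.
Qed.

Lemma deep_ht (v : selfbij hoitv) n : deep v n -> is_higman_thompson k v.
Proof.
move=> vn.
pose I (i : 'I_(r * k ^ n)) := (n, i : nat).
have Is i : kstd (I i) by rewrite /kstd /=.
have /choice[J JP] : forall i, exists q, kstd q /\ aff_on v (I i) q.
  by move=> i; have [q] := vn _ (Is i) (leqnn _); exists q.
exists _, I, J, 1%g; split.
- split=> //; split.
  + apply/seteqP; split=> x.
      by move=> [i _ Ii]; rewrite /= in_itv /=; apply: kitv_hoitv Ii.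
    rewrite /= in_itv /= => xr; have [[m a] [/= -> ps px]] := kitv_ex (Hoitv xr) n.
    by exists (Ordinal ps).
  + move=> i j _ _ [x [Ii Ij]]; apply/val_inj.
    by have [] := kitv_depth Ii Ij erefl.
  + by move=> i _; exists (klo (I i)); apply: klo_in.
- split; first by move=> i; case: (JP i).
  split.
  + apply/seteqP; split=> y.
      by move=> [i _ Ji]; rewrite /= in_itv /=; apply: kitv_hoitv Ji; case: (JP i).
    rewrite /= in_itv /= => yr; set y' := Hoitv yr.
    have [[m a] [/= mn ps px]] := kitv_ex ((v^-1)%g y') n.
    rewrite {}mn in ps px; exists (Ordinal ps) => //.
    have [_ vJ] := JP (Ordinal ps).
    have := vJ _ px; rewrite selfbijVK /= => ->.
    exact: kaffine_in.
  + move=> i j _ _ [y [Ji Jj]].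
    have [Jis vi] := JP i; have [Jjs vj] := JP j.
    have hi := kaffine_in (I i) Ji; have hj := kaffine_in (I j) Jj.
    have [x xE] := hoitv_of (Is i) hi; have [x' x'E] := hoitv_of (Is j) hj.
    rewrite -xE in hi; rewrite -x'E in hj.
    have vx := vi _ hi; have vx' := vj _ hj.
    rewrite xE kaffineK in vx; rewrite x'E kaffineK in vx'.
    have xx' : x = x' by apply: (bij_inj (selfbijP v)); apply: val_inj; rewrite /= vx vx'.
    rewrite xx' in hi; apply/val_inj.
    by have [] := kitv_depth hi hj erefl.
  + by move=> i _; exists (klo (J i)); apply: klo_in.
- by move=> i x Ix; rewrite perm1; case: (JP i) => _; apply.
Qed.

Let deep_comp (v w : selfbij hoitv) n m :
  deep v n -> deep w m -> deep (v * w)%g (m + n).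
Proof.
move=> vn wm p ps pn.
have mp : (m <= p.1)%N := leq_trans (leq_addr _ _) pn.
have [p' [s [p'm sk sE p's ->]]] := ksub_ex mp ps.
have [q' q's wq] : exists2 q, kstd q & aff_on w p' q by apply: wm; rewrite ?p'm.
have qs : kstd (ksub q' s) by exact: kstd_sub.
have [t ts vt] : exists2 t, kstd t & aff_on v (ksub q' s) t.
  by apply: vn => //=; rewrite sE (leq_trans _ (leq_addl _ _))// leq_subRL.
have ws := aff_sub sk wq.
exists t => // x px; have wx := ws _ px.
rewrite selfbijM vt; last by rewrite wx; apply: kaffine_in.
by rewrite wx kaffine_comp.
Qed.

Lemma higman_thompson_closed :
  group_closed (fun v : selfbij hoitv => `[< is_higman_thompson k v >]).
Proof.
have inv (v : selfbij hoitv) : is_higman_thompson k v -> is_higman_thompson k (v^-1)%g.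
  move=> [N [I [J [s [Ip Jp vE]]]]]; exists N, J, I, (s^-1)%g; split=> // i x Jx.
  have [[Is _] _] := (Ip, Jp).
  have hi := kaffine_in (I ((s^-1)%g i)) Jx.
  have [y yE] := hoitv_of (Is _) hi; rewrite -yE in hi *.
  have := vE _ _ hi; rewrite permKV yE kaffineK => vy.
  have vyx : v y = x by apply/val_inj.
  by rewrite -vyx selfbijK yE -vyx.
split.
  apply/asboolP/(@deep_ht _ 0%N) => p ps _; exists p => // x _.
  by rewrite selfbij1; apply: kaffine_uniq.
move=> v w /asboolP/ht_deep[n vn] /asboolP/inv/ht_deep[m wm].
by apply/asboolP/deep_ht/deep_comp; [apply: vn|apply: wm].
Qed.

Lemma ht_local (v : hoitv -> hoitv) (x : hoitv) n : deep v n ->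
  exists p q, [/\ kstd p, kstd q, kitv p x & aff_on v p q].
Proof.
move=> vn; have [p [pn ps px]] := kitv_ex x n.
by have [|q qs vq] := vn _ ps; [rewrite pn|exists p, q].
Qed.

Let slope (v : hoitv -> hoitv) (x : hoitv) (m : int) : Prop :=
  exists2 d : R, 0 < d & forall y : hoitv, (x : R) <= (y : R) < (x : R) + d ->
    v y = (v x : R) + K ^ m * ((y : R) - (x : R)) :> R.

Let itv_right (x : hoitv) : exists2 d : R, 0 < d & forall y : R,
  (x : R) <= y < (x : R) + d -> 0 <= y < r%:R.
Proof.
case: x => x /= /andP[x0 xr]; exists (r%:R - x); first by rewrite subr_gt0.
by move=> y; rewrite addrC subrK => /andP[xy ->]; rewrite (le_trans x0).
Qed.

Lemma hoextE (v : hoitv -> hoitv) (x : hoitv) : hoext v x = v x.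
Proof. by rewrite /hoext (_ : insub _ = Some x)//; apply: valK. Qed.

Lemma right_derivative_slope v x m : slope v x m ->
  right_derivative (hoext v) x = K ^ m.
Proof.
move=> [d d0 vE]; have [e e0 xe] := itv_right x.
apply: cvg_lim => //.
apply: (@cvg_trans _ (cst (K ^ m) @ (0 : R)^'+)); last exact: cvg_cst.
apply: near_eq_cvg; near=> h.
have h0 : 0 < h by near: h; exact: nbhs_right_gt.
have hd : h < d by near: h; exact: nbhs_right_lt.
have he : h < e by near: h; exact: nbhs_right_lt.
have xh : (x : R) <= (x : R) + h by rewrite lerDl ltW.
have yr : 0 <= (x : R) + h < r%:R by apply: xe; rewrite xh ltrD2l.
rewrite /cst (hoextE v x) -[(x : R) + h]/(hoitv_val (Hoitv yr)) hoextE vE /=.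
  by rewrite addrAC subrr add0r addrAC subrr add0r mulrC mulfK ?gt_eqF.
by rewrite xh ltrD2l.
Unshelve. all: by end_near. Qed.

Lemma logk_exp (m : int) : logk k (K ^ m) = m.
Proof.
rewrite /logk; case: xgetP => [n _ /= |/(_ m)]; last by move=> h; case: (h erefl).
apply: ieexprIz => //.
by rewrite gt_eqF// ltr1n.
Qed.


Let aff_slope v (x : hoitv) p q : kitv p x -> aff_on v p q ->
  slope v x (p.1%:Z - q.1%:Z).
Proof.
move=> px vpq; have := px; rewrite /kitv /= in_itv /= => /andP[lx xh].
exists (khi p - (x : R)); first by rewrite subr_gt0.
move=> y; rewrite addrC subrK => /andP[xy yh].
have py : kitv p y by rewrite /kitv /= in_itv /= yh (le_trans lx).
rewrite (vpq _ py) (vpq _ px) !kaffineE expfzDr ?gt_eqF// -exprnN -exprnP; ring.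
Qed.

Let ht_slope v (x : hoitv) : is_higman_thompson k v -> exists m, slope v x m.
Proof.
move=> /ht_deep[n /(@ht_local _ x)[p [q [_ _ px vpq]]]].
by exists (p.1%:Z - q.1%:Z); apply: aff_slope.
Qed.

Let slope_comp (v w : selfbij hoitv) (x : hoitv) m n :
  slope v (w x) m -> slope w x n -> slope (v * w)%g x (m + n).
Proof.
move=> [d d0 vE] [e e0 wE].
have Kn : 0 < K ^ n by rewrite exprz_gt0.
exists (Num.min e (d / K ^ n)); first by rewrite lt_min e0 divr_gt0.
move=> y; rewrite -ltrBlDl lt_min ltrBlDl => /andP[xy /andP[ye yd]].
have wy : w y = (w x : R) + K ^ n * ((y : R) - (x : R)) :> R by apply: wE; rewrite xy.
rewrite !selfbijM vE; last first.
  rewrite wy lerDl mulr_ge0 ?subr_ge0 ?(ltW Kn)//=.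
  by rewrite ltrD2l mulrC -ltr_pdivlMr.
by rewrite wy [_ + _ * _ - _]addrC addKr expfzDr ?gt_eqF// mulrA.
Qed.

(* log_k (v' x), where v' is the right derivative *)
Definition logderiv (v : hoitv -> hoitv) (x : R) : int :=
  logk k (right_derivative (hoext v) x).

Lemma logderivM (v w : selfbij hoitv) (x : hoitv) :
  is_higman_thompson k v -> is_higman_thompson k w ->
  logderiv (v * w)%g x = logderiv v (w x) + logderiv w x.
Proof.
move=> /(ht_slope (w x))[m vm] /(ht_slope x)[n wn].
have vwmn := slope_comp vm wn.
by rewrite /logderiv !(right_derivative_slope vm, right_derivative_slope wn,
  right_derivative_slope vwmn) !logk_exp.
Qed.

Lemma logderiv1 (x : hoitv) : logderiv (1%g : selfbij hoitv) x = 0.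
Proof.
have s1 : slope (1%g : selfbij hoitv) x 0.
  by exists 1 => // y _; rewrite !selfbij1 expr0z mul1r addrC subrK.
by rewrite /logderiv (right_derivative_slope s1) logk_exp.
Qed.

Lemma ht_kadic v (x : hoitv) : is_higman_thompson k v ->
  is_kadic k (x : R) -> is_kadic k (v x : R).
Proof.
move=> /ht_deep[d /(@ht_local _ x)[p [q [_ _ px vpq]]]] [a [n xE]].
exists ((q.2%:Z - p.2%:Z) * (k ^ n)%N%:Z + a * (k ^ p.1)%N%:Z), (n + q.1)%N.
have := kaffine_scale p q x; rewrite -(vpq _ px) => /eqP.
rewrite subr_eq => /eqP e.
rewrite -[LHS](mulfK (Kn_neq0 q.1)) e xE !exprD invfM mulrA; congr (_ / _).
rewrite intrD !intrM intrB -!pmulrn !natrX.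
by field; rewrite Kn_neq0.
Qed.

End HigmanThompsonTheory.

Section HigmanThompsonGroup.
Variables (R : realType) (k r : nat).

(* [1 < k] is a parameter because it is needed for the group structure. *)
Record higman_thompson (hk : (1 < k)%N) := HigmanThompson {
  ht_bij :> selfbij (hoitv R r);
  _ : `[< is_higman_thompson k ht_bij >] }.

Variable hk : (1 < k)%N.
Local Notation V := (higman_thompson hk).

HB.instance Definition _ := [isSub for @ht_bij hk].
HB.instance Definition _ := [Choice of V by <:].
HB.instance Definition _ := SubChoice_isSubGroup.Build (selfbij (hoitv R r)) _ V
  (@higman_thompson_closed R k r hk).

Lemma htP (v : V) : is_higman_thompson k v.
Proof. by apply/asboolP; case: v. Qed.

(* The set Q_k(0, r) of k-adic rationals in [0, r) *)
Record kadic_point := KadicPoint {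
  kadic_val :> hoitv R r;
  _ : `[< is_kadic k (kadic_val : R) >] }.

HB.instance Definition _ := [isSub for kadic_val].
HB.instance Definition _ := [Choice of kadic_point by <:].

Lemma kadicP (x : kadic_point) : is_kadic k (x : R).
Proof. by apply/asboolP; case: x. Qed.

Definition kadic_act (v : V) (x : kadic_point) : kadic_point :=
  KadicPoint (asboolT (@ht_kadic R k r hk v x (htP v) (kadicP x))).

Lemma kadic_act1 x : kadic_act 1%g x = x.
Proof. exact/val_inj. Qed.
Lemma kadic_actM (v w : V) x : kadic_act (v * w)%g x = kadic_act v (kadic_act w x).
Proof. exact/val_inj. Qed.
Lemma kadic_actK (v : V) : cancel (kadic_act v) (kadic_act v^-1%g).
Proof. by move=> x; rewrite -kadic_actM mulVg kadic_act1. Qed.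
Lemma kadic_actVK (v : V) : cancel (kadic_act v^-1%g) (kadic_act v).
Proof. by move=> x; rewrite -kadic_actM mulgV kadic_act1. Qed.

End HigmanThompsonGroup.

Section TwistedWreathProduct.
Variables (R : realType) (Gamma : groupType) (theta : autG Gamma).
Variables (k r : nat) (hk : (1 < k)%N).
Local Notation V := (higman_thompson R r hk).
Local Notation Q := (kadic_point R k r).
Local Notation dsum := (direct_sum Q Gamma).

(* (v . a) x = theta ^ (log_k (v' (v^-1 x))) (a (v^-1 x)) for all x, see
   [twist_funE]; the support of v . a is the image of that of a by v. *)
Definition twist_fun (v : V) (a : dsum) : dsum :=
  [fsfun x in [fset kadic_act v y | y in finsupp a]%fset =>
    let y := kadic_act v^-1%g x in expgz theta (logderiv k v y) (a y)].

Lemma twist_funE (v : V) (a : dsum) (x : Q) :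
  twist_fun v a x = expgz theta (logderiv k v (kadic_act v^-1%g x))
    (a (kadic_act v^-1%g x)).
Proof.
rewrite /twist_fun fsfunE /=; case: ifPn => // /imfsetP /= h.
rewrite (@dsum_out _ _ a) ?autG_fix1//; apply/negP => ya; apply: h.
by exists (kadic_act v^-1%g x) => //; rewrite kadic_actVK.
Qed.

Lemma twist_fun1 (a : dsum) : twist_fun 1%g a = a.
Proof.
apply: dsum_ext => x; rewrite twist_funE invg1 kadic_act1.
by rewrite logderiv1// autG1.
Qed.

Lemma twist_funM (v w : V) (a : dsum) :
  twist_fun (v * w)%g a = twist_fun v (twist_fun w a).
Proof.
apply: dsum_ext => x; rewrite !twist_funE invgM kadic_actM.
set y := kadic_act _ _; rewrite -autGM -expgzD.
rewrite (logderivM hk _ (htP v) (htP w)).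
by rewrite -[ht_bij w (kadic_val _)]/(kadic_val (kadic_act w _)) kadic_actVK.
Qed.

Lemma twist_morph (v : V) : {morph twist_fun v : a b / (a * b)%g}.
Proof.
by move=> a b; apply: dsum_ext => x; rewrite dsumM !twist_funE dsumM autG_morph.
Qed.

Lemma twist_bij (v : V) : bijective (twist_fun v).
Proof.
by exists (twist_fun v^-1%g) => a; rewrite -twist_funM ?mulVg ?mulgV twist_fun1.
Qed.

Definition twist (v : V) : autG dsum := mk_autG (twist_bij v) (twist_morph v).

Lemma twistM : {morph twist : v w / (v * w)%g}.
Proof. by move=> v w; apply: autG_ext => a; exact: twist_funM. Qed.

HB.instance Definition _ := isMultiplicative.Build V (autG dsum) twist twistM.

Definition twisted_wreath : groupType := semidirect (twist : {multiplicative V -> autG dsum}).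

End TwistedWreathProduct.

(* Main.v *)
Require Import Defs.
From HB Require Import structures.
From mathcomp Require Import all_boot all_order all_algebra.
From mathcomp Require Import complex finmap.
From mathcomp Require Import boolp classical_sets functions cardinality fsbigop.
From mathcomp Require Import reals topology normedtype sequences.
From mathcomp Require Import ring lra zify.

(* Two kinds of positive definite functions on the wreath product are multiplied.

   The first is [t ^ zlength g] with [0 <= t < 1].  An element [(a, v)] is nice
   on a standard interval [p] if [v] maps [p] affinely onto a standard interval
   [q] and [a] is trivial on [q] except perhaps at its left endpoint.  All deep
   intervals are nice, because a k-adic point is the left endpoint of every deep
   interval containing it.  Identifying [(g, p)] with [(h, q)] when [h^-1 g] is
   nice from [p] to [q], the classes of the [(g, p)], [p] standard, form a set
   [cells g] which differs from [cells h] by finitely many classes ("zipper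
   action"), and [zlength g] is the cardinality of the symmetric difference of
   [cells 1] and [cells g].  If it is at most [n], then [g] is nice on all
   intervals of depth [n], with images of depth at most [2n]; this leaves
   finitely many [v], and finitely many points in the support of [a].

   The second controls the values of [a].  If [v] is affine from [p] to [q], then
   the k-adic depth of [v x] minus that of [x] is the depth of [q] minus that of
   [p] for all k-adic [x] in [p] other than its left endpoint.  So the cocycle
   [log_k v'] is cohomologous, through the depth, to a finitely supported one, and
   the twisted wreath product embeds into the untwisted wreath product of
   [Gamma x| Z] by [V].  As [Z] is amenable, [Gamma x| Z] has the Haagerup
   property; the product over all points of a positive definite function on it
   is invariant under permutation of the points, hence positive definite on the
   whole wreath product. *)

Set Implicit Arguments.
Unset Strict Implicit.
Unset Printing Implicit Defensive.

Import Order.TTheory GRing.Theory Num.Theory.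
Import numFieldNormedType.Exports.
Local Open Scope classical_set_scope.
Local Open Scope ring_scope.

(** * Positive definite kernels *)

Section PositiveDefiniteKernels.
Variable C : numClosedFieldType.

(** Families are indexed by an arbitrary finite type and may repeat points, so that [bool] and
    product types can serve as index sets. *)
Definition pdkernel (X : Type) (K : X -> X -> C) : Prop :=
  forall (T : finType) (c : T -> C) (g : T -> X),
    0 <= \sum_i \sum_j (c i)^* * c j * K (g i) (g j).

Section Closure.
Variable X : Type.
Implicit Types K L : X -> X -> C.

Lemma eq_pdkernel K L : (forall x y, K x y = L x y) -> pdkernel K -> pdkernel L.
Proof.
by move=> KL; rewrite (_ : L = K)//; apply/funext => x; apply/funext => y.
Qed.

Lemma pdkernel_pull (Y : Type) (f : Y -> X) K :
  pdkernel K -> pdkernel (fun x y => K (f x) (f y)).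
Proof. by move=> Kpd T c g; apply: (Kpd T c (f \o g)). Qed.

Lemma pdkernel_rank1 (f : X -> C) : pdkernel (fun x y => (f x)^* * f y).
Proof.
move=> T c g.
suff <- : (\sum_i c i * f (g i))^* * \sum_i c i * f (g i) =
    \sum_i \sum_j (c i)^* * c j * ((f (g i))^* * f (g j)).
  by rewrite mulrC mul_conjC_ge0.
rewrite rmorph_sum big_distrl/=; apply: eq_bigr => i _.
by rewrite big_distrr/=; apply: eq_bigr => j _; rewrite rmorphM/=; ring.
Qed.

Lemma pdkernel_cst (a : C) : 0 <= a -> pdkernel (fun _ _ : X => a).
Proof.
move=> a0; apply: eq_pdkernel (pdkernel_rank1 (fun=> sqrtC a)) => x y.
by rewrite conj_Creal ?ger0_real ?sqrtC_ge0// -expr2 sqrtCK.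
Qed.

Lemma pdkernelD K L : pdkernel K -> pdkernel L -> pdkernel (fun x y => K x y + L x y).
Proof.
move=> Kpd Lpd T c g.
apply: le_trans (addr_ge0 (Kpd T c g) (Lpd T c g)) _; rewrite le_eqVlt.
apply/orP; left; apply/eqP; rewrite -big_split; apply: eq_bigr => i _; rewrite -big_split.
by apply: eq_bigr => j _; rewrite mulrDr.
Qed.

Lemma pdkernel_sum (I : Type) (r : seq I) (K : I -> X -> X -> C) :
  (forall l, pdkernel (K l)) -> pdkernel (fun x y => \sum_(l <- r) K l x y).
Proof.
move=> Kpd; elim: r => [|l r IHr].
  by apply: eq_pdkernel (pdkernel_cst (lexx 0)) => x y; rewrite big_nil.
by apply: eq_pdkernel (pdkernelD (Kpd l) IHr) => x y; rewrite big_cons.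
Qed.

(** Polarization: positivity at one and two points makes [a * K x y + a^* * K y x] real for every
    [a]; the cases [a = 1] and [a = 'i] give the claim. *)
Lemma pdkernel_herm K : pdkernel K -> forall x y, K y x = (K x y)^*.
Proof.
move=> Kpd x y.
have diag z : K z z \is Num.real.
  have := Kpd unit (fun=> 1) (fun=> z).
  by rewrite !big_const !cardT !enumT !unlock/= !addr0 conjC1 !mul1r => /ger0_real.
pose g (b : bool) := if b then x else y.
have two (a : C) : a * K x y + a^* * K y x \is Num.real.
  have := Kpd bool (fun b => if b then 1 else a) g.
  rewrite !big_bool /= conjC1 !mul1r => /ger0_real.
  have -> : K x x + a * K x y + (a^* * 1 * K y x + a^* * a * K y y)
     = (a * K x y + a^* * K y x) + (K x x + a * a^* * K y y) by ring.
  by rewrite rpredDr// rpredD// rpredM// -normCK rpredX// normr_real.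
have /CrealP := two 1; rewrite conjC1 !mul1r rmorphD /= => h1.
have /CrealP := two 'i; rewrite conjCi rmorphD !rmorphM rmorphN /= conjCi => h2.
have {}h2 : (K y x)^* - (K x y)^* = K x y - K y x.
  apply: (mulfI (neq0Ci C)).
  by move: h2; rewrite opprK; move: ((K x y)^*) ((K y x)^*) => u v h2; transitivity ('i * K x y + - 'i * K y x); [rewrite -h2; ring|ring].
move: h1 h2; move: ((K x y)^*) ((K y x)^*) => u v h1 h2.
have two0 : (2 : C) != 0 by rewrite pnatr_eq0.
apply: (mulfI two0).
transitivity ((K x y + K y x) - (K x y - K y x)); first by ring.
by rewrite -h1 -h2; ring.
Qed.

End Closure.

(** Spectral theorem: [A] is diagonalized by a unitary [P] with nonnegative eigenvalues, whose
    square roots scale the rows of [P]. *)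
Lemma psd_gram n (A : 'I_n -> 'I_n -> C) :
  (forall c : 'I_n -> C, 0 <= \sum_i \sum_j (c i)^* * c j * A i j) ->
  (forall i j, A j i = (A i j)^*) ->
  exists B : 'I_n -> 'I_n -> C, forall i j, A i j = \sum_l (B l i)^* * B l j.
Proof.
move=> Apsd Aherm; pose M := \matrix_(i, j) A i j.
have Mh : M \is hermsymmx.
  apply/is_hermitianmxP; rewrite expr0 scale1r; apply/matrixP => i j.
  by rewrite !mxE Aherm.
have /hermitian_normalmx/orthomx_spectralP := Mh.
set P := spectralmx M; set D := spectral_diag M => ME.
have Pu : P \is unitarymx := spectral_unitarymx M.
have MD : diag_mx D = P *m M *m (P ^t*)%sesqui.
  rewrite ME -(invmx_unitary Pu) !mulmxA mulmxV ?spectral_unit// mul1mx -mulmxA mulmxV ?spectral_unit//.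
  by rewrite mulmx1.
(* The eigenvalue is the quadratic form at the conjugate of row [l] of [P]. *)
have D0 l : 0 <= D 0 l.
  have := Apsd (fun i => (P l i)^*); congr (0 <= _).
  have /matrixP/(_ l l) := MD; rewrite !mxE eqxx mulr1n => ->.
  rewrite exchange_big /=; apply: eq_bigr => j _.
  rewrite !mxE mulr_suml; apply: eq_bigr => i _.
  by rewrite !mxE conjCK; ring.
exists (fun l j => sqrtC (D 0 l) * P l j) => i j.
have /matrixP/(_ i j) := ME; rewrite mxE => ->.
rewrite (invmx_unitary Pu) mul_mx_diag !mxE; apply: eq_bigr => l _.
rewrite !mxE rmorphM /= (@conj_Creal _ (sqrtC _)) ?ger0_real ?sqrtC_ge0//.
by rewrite -{1}(sqrtCK (D 0 l)); ring.
Qed.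

(** Schur product theorem: with [K] written as a Gram matrix on the given points, the form of the
    product at [c] is a sum over [l] of forms of [L] with coefficients [c i * b l i]. *)
Lemma pdkernelM (X : Type) (K L : X -> X -> C) :
  pdkernel K -> pdkernel L -> pdkernel (fun x y => K x y * L x y).
Proof.
move=> Kpd Lpd T c g; pose e (i : 'I_#|T|) := g (enum_val i).
have [|i j|B BE] := @psd_gram _ (fun i j => K (e i) (e j)).
- by move=> c'; apply: (Kpd _ c' e).
- exact: pdkernel_herm.
pose b l i := B l (enum_rank i).
have KE i j : K (g i) (g j) = \sum_l (b l i)^* * b l j.
  by rewrite -BE /e !enum_rankK.
apply: le_trans (_ : \sum_l \sum_i \sum_j (c i * b l i)^* * (c j * b l j) * L (g i) (g j) <= _).
  by apply: sumr_ge0 => l _; apply: Lpd.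
rewrite le_eqVlt; apply/orP; left; apply/eqP.
rewrite exchange_big; apply: eq_bigr => i _.
rewrite exchange_big; apply: eq_bigr => j _.
rewrite KE mulr_suml mulr_sumr; apply: eq_bigr => l _.
by rewrite rmorphM /=; ring.
Qed.

Lemma pdkernel_prod (X I : Type) (r : seq I) (K : I -> X -> X -> C) :
  (forall l, pdkernel (K l)) -> pdkernel (fun x y => \prod_(l <- r) K l x y).
Proof.
move=> Kpd; elim: r => [|l r IHr].
  by apply: eq_pdkernel (pdkernel_cst ler01) => x y; rewrite big_nil.
by apply: eq_pdkernel (pdkernelM (Kpd l) IHr) => x y; rewrite big_cons.
Qed.

(** Positivity tests finitely many points at a time; this reduces infinite products to finite
    ones. *)
Lemma pdkernel_finite (X : Type) (K : X -> X -> C) :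
  (forall (T : finType) (g : T -> X), exists2 L, pdkernel L &
     forall i j, K (g i) (g j) = L (g i) (g j)) -> pdkernel K.
Proof.
move=> KL T c g; have [L Lpd E] := KL T g.
apply: le_trans (Lpd T c g) _; rewrite le_eqVlt; apply/orP; left; apply/eqP.
by apply: eq_bigr => i _; apply: eq_bigr => j _; rewrite E.
Qed.

Lemma pdkernel_eq (X : eqType) : pdkernel (fun x y : X => (x == y)%:R).
Proof.
apply: pdkernel_finite => T g.
exists (fun x y => \sum_(z <- undup [seq g i | i : T]) ((x == z)%:R)^* * (y == z)%:R).
  by apply: pdkernel_sum => z; apply: pdkernel_rank1.
move=> i j; rewrite (bigD1_seq (g i)) ?undup_uniq//=; last first.
  by rewrite mem_undup map_f ?mem_enum.
rewrite eqxx conjC1 mul1r eq_sym big1 ?addr0// => z /negPf.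
by rewrite eq_sym => ->; rewrite conjC0 mul0r.
Qed.

(** The form is that of [K] on the family indexed by [T * F], with coefficients constant along
    [F]. *)
Lemma pdkernel_fiber_sum (X : Type) (F : finType) (K : X * F -> X * F -> C) :
  pdkernel K -> pdkernel (fun x y => \sum_i \sum_j K (x, i) (y, j)).
Proof.
move=> Kpd T c g.
apply: le_trans (Kpd _ (fun p : T * F => c p.1) (fun p => (g p.1, p.2))) _.
rewrite le_eqVlt; apply/orP; left; apply/eqP.
rewrite -(pair_bigA _ (fun x i => \sum_p (c x)^* * c p.1 * K (g x, i) (g p.1, p.2)))/=.
apply: eq_bigr => x _; under eq_bigr => i _ do
  rewrite -(pair_bigA _ (fun y j => (c x)^* * c y * K (g x, i) (g y, j)))/=.
rewrite exchange_big/=; apply: eq_bigr => y _; rewrite mulr_sumr.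
by apply: eq_bigr => i _; rewrite mulr_sumr.
Qed.

Lemma pdkernel_norm_le1 (X : Type) (K : X -> X -> C) x y :
  pdkernel K -> K x x = 1 -> K y y = 1 -> `|K x y| <= 1.
Proof.
move=> Kpd Kx Ky; have [->|K0] := eqVneq (K x y) 0; first by rewrite normr0.
(* With these coefficients the form equals [2 |K x y|^2 (1 - |K x y|)]. *)
have := Kpd bool (fun b => if b then K x y else - `|K x y|) (fun b => if b then x else y).
rewrite !big_bool /= Kx Ky (pdkernel_herm Kpd x y) rmorphN /= conj_normC.
have -> : (K x y)^* * K x y * 1 + (K x y)^* * - `|K x y| * K x y +
   (- `|K x y| * K x y * (K x y)^* + - `|K x y| * - `|K x y| * 1) =
   K x y * (K x y)^* *+ 2 - `|K x y| * (K x y * (K x y)^*) *+ 2 + (`|K x y| ^+ 2 - K x y * (K x y)^*)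
   + (K x y * (K x y)^*  - K x y * (K x y)^*) by ring.
rewrite -normCK !subrr !addr0 -mulrnBl pmulrn_lge0// -{1}[_ ^+ 2]mul1r -mulrBl.
by rewrite pmulr_lge0 ?subr_ge0// exprn_gt0// normr_gt0.
Qed.

End PositiveDefiniteKernels.

(** * Approximation by positive definite functions *)

Section Groups.
Variable R : realType.
Local Notation C := R[i].

Lemma positive_definiteE (G : groupType) (phi : G -> C) :
  positive_definite phi <-> pdkernel (fun g h => phi (g^-1 * h)%g).
Proof.
split=> [pd T c g|pd n c g]; last exact: (pd _ c g).
apply: le_trans (pd #|T| (c \o enum_val) (g \o enum_val)) _.
rewrite le_eqVlt; apply/orP; left; apply/eqP.
rewrite [RHS](reindex _ (onW_bij _ (@enum_val_bij T))).
apply: eq_bigr => i _; rewrite [RHS](reindex _ (onW_bij _ (@enum_val_bij T))).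
exact: eq_bigr.
Qed.

Lemma positive_definiteM (G : groupType) (phi psi : G -> C) :
  positive_definite phi -> positive_definite psi ->
  positive_definite (fun g => phi g * psi g).
Proof.
move=> /positive_definiteE h /positive_definiteE h'; apply/positive_definiteE.
exact: pdkernelM h h'.
Qed.

(** Reindexing by [act g] turns the product at [g^-1 * h] into the product of the [K i g h]. For
    finitely many group elements only finitely many indices give a factor other than 1, so a finite
    product of kernels agrees with it. *)
Lemma positive_definite_prod (G : groupType) (I : choiceType) (act : G -> I -> I)
    (K : I -> G -> G -> C) :
  (forall l, bijective (act l)) ->
  (forall l i g h, K (act l i) (l * g)%g (l * h)%g = K i g h) ->
  (forall i, pdkernel (K i)) ->
  (forall g h, finite_set [set i | K i g h <> 1]) ->
  positive_definite (fun g => \big[*%R/1]_(i \in [set: I]) K i 1%g g).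
Proof.
move=> actb Kact Kpd Kfin; apply/positive_definiteE/pdkernel_finite => T g.
pose S := \bigcup_(p in [set: T * T]) [set i | K i (g p.1) (g p.2) <> 1].
have Sfin : finite_set S by apply: bigcup_finite => // p _; apply: Kfin.
exists (fun x y => \prod_(i <- fset_set S) K i x y); first exact: pdkernel_prod.
move=> i j; transitivity (\big[*%R/1]_(z \in [set: I]) K z (g i) (g j)).
  rewrite [RHS](reindex_fsbigT (act (g i)))//; apply: eq_fsbigr => z _.
  by rewrite -[LHS](Kact (g i)) mulg1 mulVKg.
rewrite (fsbigTE (fset_set S))// => z; rewrite in_fset_set//.
move=> zS; apply: contrapT => Kz; move/negP: zS; apply; apply/mem_set.
by exists (i, j).
Qed.

(** The Haagerup property without nets, normalized at the identity so that the kernels built from it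
    have diagonal 1. *)
Definition approximable (G : groupType) : Prop :=
  forall (F : seq G) (e : R), 0 < e -> exists phi : G -> C,
  [/\ positive_definite phi, vanishes_at_infinity phi, phi 1%g = 1 &
      forall g, g \in F -> `|phi g - 1| < e%:C%C].

Lemma directed_all (I : Type) (le : I -> I -> Prop) (X : eqType) (F : seq X)
    (P : X -> I -> Prop) :
  directed le -> (forall x, x \in F -> exists i0, forall i, le i0 i -> P x i) ->
  exists i, forall x, x \in F -> P x i.
Proof.
move=> [[i0] refl tr dir] FP.
suff [i iP] : exists i, forall j, le i j -> forall x, x \in F -> P x j.
  by exists i; apply: iP.
elim: F FP => [|x F IH] FP; first by exists i0.
have [i iP] := IH (fun y yF => FP y (mem_behead (s := x :: F) yF)).
have [j jP] := FP x (mem_head _ _); have [l [il jl]] := dir i j.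
exists l => m lm y; rewrite inE => /predU1P[->|]; first by apply: jP; apply: tr lm.
by apply: iP; apply: tr lm.
Qed.

Lemma haagerup_approximable (G : groupType) : haagerup R G -> approximable G.
Proof.
move=> [I [le [phi [dir pd van cvg]]]] F e e0.
(* The bound 1/2 gives [|a| > 1/2]; the bound e/4 gives [|phi i g - a| < e/2], hence an error below
   [e] after division by [a]. *)
pose d : R := Num.min (1 / 2) (e / 4).
have d0 : 0 < d by rewrite lt_min; lra.
have [i near] : exists i, forall g, g \in 1%g :: F -> `|phi i g - 1| < d%:C%C.
  by apply: directed_all dir _ => g _; apply: cvg.
set a := phi i 1%g.
have a1 : `|a - 1| < d%:C%C by apply: near; rewrite mem_head.
have halfE : (1 / 2 : C) = (1 / 2 : R)%:C%C by rewrite rmorphM fmorphV rmorph1 rmorphMn.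
have half : (1 / 2 : C) < `|a|.
  have h : 1 - `|a| < 1 / 2.
    have := lerB_dist 1 a; rewrite normr1 distrC => /le_lt_trans; apply.
    by apply: lt_le_trans a1 _; rewrite halfE lecR ge_min lexx.
  rewrite -subr_gt0 (_ : _ - _ = 1 / 2 - (1 - `|a|)) ?subr_gt0//; by field.
have a0 : 0 <= a.
  have := pd i 1%N (fun=> 1) (fun=> 1%g).
  by rewrite !big_ord1 conjC1 !mul1r mulVg.
have an0 : a != 0 by apply: contraTneq half => ->; rewrite normr0 le_gtF// divr_ge0.
exists (fun g => phi i g / a); split.
- apply/positive_definiteE.
  apply: pdkernelM; first exact/positive_definiteE.
  by apply: pdkernel_cst; rewrite invr_ge0.
- move=> eps eps0; have aE : a = (complex.Re a)%:C%C by rewrite RRe_real// ger0_real.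
  have ra0 : 0 < complex.Re a.
    by rewrite -ltcR -aE lt_def an0.
  apply: sub_finite_set (van i (eps * complex.Re a) (mulr_gt0 eps0 ra0)) => g /=.
  rewrite normrM normfV (ger0_norm a0) ler_pdivlMr; last by rewrite lt_def an0.
  by rewrite rmorphM /= -aE.
- by rewrite divff.
- move=> g gF.
  have gd : `|phi i g - 1| < d%:C%C by apply: near; rewrite inE gF orbT.
  rewrite (_ : _ - 1 = (phi i g - a) / a); last by rewrite mulrBl divff.
  rewrite normrM normfV ltr_pdivrMr ?normr_gt0//.
  have : `|phi i g - a| < (d + d)%:C%C.
    rewrite (_ : _ - a = (phi i g - 1) - (a - 1)); last by ring.
    apply: le_lt_trans (ler_normB _ _) _; rewrite rmorphD /=; exact: ltrD.
  move/lt_le_trans; apply.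
  apply: le_trans (_ : e%:C%C * (1 / 2) <= _); last first.
    by rewrite ler_wpM2l ?lecR ?ltW.
  rewrite halfE -rmorphM lecR.
  have : d <= e / 4 by rewrite ge_min lexx orbT.
  lra.
Qed.

Lemma approximable_haagerup (G : groupType) : approximable G -> haagerup R G.
Proof.
move=> ap.
have /choice[phi phiP] : forall p : seq G * nat, exists phi : G -> C,
    [/\ positive_definite phi, vanishes_at_infinity phi &
     forall g, g \in p.1 -> `|phi g - 1| < ((p.2.+1%:R)^-1 : R)%:C%C].
  move=> p; have [|phi [h1 h2 _ h3]] := ap p.1 ((p.2.+1%:R)^-1); last by exists phi.
  by rewrite invr_gt0 ltr0n.
(* An index is a finite list of elements on which to approximate, with a number [n] for the
   precision [1/(n+1)]. *)
exists (seq G * nat)%type, (fun p q => {subset p.1 <= q.1} /\ (p.2 <= q.2)%N), phi; split.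
- split; first by constructor; exact: ([::], 0%N).
  + by move=> i; split.
  + by move=> i j l [h1 h2] [h3 h4]; split; [move=> x /h1/h3|apply: leq_trans h4].
  + move=> i j; exists (i.1 ++ j.1, maxn i.2 j.2) => /=.
    rewrite leq_maxl leq_maxr; split; split=> // x; rewrite mem_cat => ->//.
    by rewrite orbT.
- by move=> i; case: (phiP i).
- by move=> i; case: (phiP i).
- move=> g e e0; exists ([:: g], Num.truncn e^-1) => i [gi ni].
  have [_ _ /(_ g)] := phiP i => h; apply: lt_le_trans (h _) _.
    by apply: gi; rewrite mem_head.
  rewrite lecR invf_ple ?posrE ?ltr0n//.
  apply: ltW; apply: lt_le_trans (truncnS_gt _) _ => //=.
  by rewrite ler_nat.
Qed.
End Groups.

(** * Extension by the integers *)

Section Folner.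
Variables (R : realType) (Gamma : groupType) (theta : autG Gamma).
Local Notation C := R[i].
Local Notation tw := (expgz theta).

Lemma complex_natr n : n%:R = (n%:R : R)%:C%C :> C.
Proof. by rewrite rmorph_nat. Qed.

Lemma twD m n x : tw (m + n) x = tw m (tw n x).
Proof. by rewrite expgzD autGM. Qed.

Lemma twK m x : tw (- m) (tw m x) = x.
Proof. by rewrite -twD addNr. Qed.

Lemma autGV (f : autG Gamma) x : f (x^-1)%g = ((f x)^-1)%g.
Proof. by apply: (@mulgI _ (f x)); rewrite -autG_morph !mulgV autG_fix1. Qed.

(* For [K (p, q) = psi (p^-1 q)] on [Gamma x| Z], where [psi] is induced from [phi]
   by means of the Folner set [{0, ..., N-1}] of [Z]. *)
Definition folner_kernel (phi : Gamma -> C) (N : nat) (p q : Gamma * int) : C :=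
  N%:R^-1 * \sum_(i < N) \sum_(j < N)
    (i%:Z + p.2 == j%:Z + q.2)%:R * phi (tw (- (i%:Z + p.2)) (p.1^-1 * q.1)%g).

(** On pairs of a point and a Folner index, the summand is a product of two pullbacks: of the
    equality kernel along [sh], and of the kernel of [phi] along [ga]. Where the first is nonzero
    both points have the same shift, so the two twists in the second agree. *)
Lemma folner_kernel_pd phi N : positive_definite phi -> pdkernel (folner_kernel phi N).
Proof.
move=> /positive_definiteE pd; apply: pdkernelM.
  by apply: pdkernel_cst; rewrite invr_ge0 ler0n.
pose sh (x : (Gamma * int) * 'I_N) : int := x.2%:Z + x.1.2.
pose ga (x : (Gamma * int) * 'I_N) := tw (- sh x) x.1.1.
have := pdkernel_fiber_sum (pdkernelM (pdkernel_pull sh (@pdkernel_eq C int)) (pdkernel_pull ga pd)).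
apply: eq_pdkernel => p q; apply: eq_bigr => i _; apply: eq_bigr => j _ /=.
rewrite /ga /sh /=; have [->|] := eqVneq; last by rewrite !mul0r.
by rewrite autG_morph autGV.
Qed.

Lemma folner_kernel_diag phi N p : (0 < N)%N -> phi 1%g = 1 -> folner_kernel phi N p p = 1.
Proof.
move=> N0 phi1; rewrite /folner_kernel mulVg.
under eq_bigr => i _.
  rewrite (bigD1 i)//= eqxx autG_fix1 phi1 mul1r big1 ?addr0; last first.
    move=> j; rewrite (inj_eq (addIr _)) eqz_nat => /negPf; rewrite eq_sym => ji.
    by rewrite (_ : (_ == _) = false) ?mul0r//.
  over.
by rewrite sumr_const card_ord mulVf// pnatr_eq0 -lt0n.
Qed.

(** This is invariance under left multiplication by [(b, c)] in [Gamma x| Z]: [b] cancels in the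
    quotient, and the twist by [c] is undone by the shifted exponent. *)
Lemma folner_kernel_inv phi N b c p q :
  folner_kernel phi N (b * tw c p.1, c + p.2)%g (b * tw c q.1, c + q.2)%g
  = folner_kernel phi N p q.
Proof.
congr (_ * _); apply: eq_bigr => i _; apply: eq_bigr => j _ /=.
rewrite !(addrCA _ c) (inj_eq (addrI _)); congr (_ * phi _).
rewrite invgM -mulgA mulKg (opprD c) [- c + _]addrC -autGV -autG_morph.
by rewrite twD twK.
Qed.

Lemma folner_kernel_fin phi N eps : (0 < N)%N -> vanishes_at_infinity phi -> 0 < eps ->
  finite_set [set q | eps%:C%C <= `|folner_kernel phi N (1%g, 0) q|].
Proof.
(* If all [N^2] terms are at most [d], the kernel is at most [N d = eps / 2]; a term above [d]
   places [q] in one of the finite sets [D (i, j)]. *)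
move=> N0 van eps0; pose d := eps / 2 / N%:R.
have NR : 0 < N%:R :> R by rewrite ltr0n.
have d0 : 0 < d by rewrite !divr_gt0.
pose D (ij : 'I_N * 'I_N) := (fun x => (tw ij.1%:Z x, ij.1%:Z - ij.2%:Z)) @`
   [set x | d%:C%C <= `|phi x|].
apply: (@sub_finite_set _ _ (\bigcup_(ij in [set: 'I_N * 'I_N]) D ij)); last first.
  by apply: bigcup_finite => // ij _; apply/finite_image/van.
move=> q /= qe; apply: contrapT => nq.
suff : `|folner_kernel phi N (1%g, 0) q| <= (eps / 2)%:C%C.
  by move=> /(le_trans qe); rewrite lecR; lra.
rewrite normrM ger0_norm ?invr_ge0 ?ler0n// mulrC ler_pdivrMr ?ltr0n//.
apply: le_trans (ler_norm_sum _ _ _) _.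
apply: le_trans (_ : \sum_(i < N) \sum_(j < N) d%:C%C <= _).
  apply: ler_sum => i _; apply: le_trans (ler_norm_sum _ _ _) _.
  apply: ler_sum => j _; rewrite normrM addr0 invg1 mul1g.
  have [e|ne] := eqVneq; last by rewrite normr0 mul0r ler0c ltW.
  rewrite normr1 mul1r real_leNgt ?normr_real ?ger0_real ?ler0c ?ltW//.
  apply/negP => h; apply: nq; exists (i, j) => //.
  exists (tw (- i%:Z) q.1); first exact: ltW.
  have nE : i%:Z - j%:Z = q.2.
    by rewrite e addrC addKr.
  rewrite -[LHS]/(tw i%:Z (tw (- i%:Z) q.1), i%:Z - j%:Z) -twD subrr nE.
  by case: (q).
rewrite !sumr_const card_ord (_ : _ *+ N = ((d *+ N) *+ N)%:C%C); last first.
  by rewrite !rmorphMn.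
rewrite complex_natr -rmorphM/=.
by rewrite lecR -(mulr_natr (d *+ N)) -(mulr_natr d) /d divfK// gt_eqF.
Qed.

Lemma sum_ltn_le (n m : nat) : (\sum_(i < n) (i < m) <= m)%N.
Proof.
suff : (\sum_(i < n) (i < m) <= minn n m)%N by rewrite leq_min => /andP[].
elim: n => [|n IHn]; first by rewrite big_ord0.
rewrite big_ord_recr /=; move: IHn; set s := (\sum_(i < n) _)%N; case: ltnP => ? /= ?; rewrite ?addn0 ?addn1 leq_min; apply/andP; lia.
Qed.

Lemma sum_ord_shift (N i : nat) (n : int) (x : C) :
  \sum_(j < N) (i%:Z == j%:Z + n)%:R * x = if (0 <= i%:Z - n < N%:Z) then x else 0.
Proof.
case: ifP => [/andP[h1 h2]|h].
  have lt : (`|i%:Z - n| < N)%N by lia.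
  rewrite (bigD1 (Ordinal lt))//= big1 => [|j jn].
    by rewrite addr0 (_ : _ == _) ?mul1r//; lia.
  rewrite (_ : (_ == _) = false) ?mul0r//; apply: contraNF jn => /eqP e.
  by apply/eqP/val_inj => /=; lia.
rewrite big1// => j _; rewrite (_ : (_ == _) = false) ?mul0r//.
move: (ltn_ord j) => jN; apply: contraFF h => /eqP e; lia.
Qed.

Lemma folner_kernel_near1 phi N (e : R) q : (0 < N)%N -> 0 < e ->
  (forall i : 'I_N, `|phi (tw (- i%:Z) q.1) - 1| <= e%:C%C) ->
  `|folner_kernel phi N (1%g, 0) q - 1| <= (e + 2 * `|q.2|%N%:R / N%:R)%:C%C.
Proof.
move=> N0 e0 near; set m := `|q.2|%N.
have NR : 0 < N%:R :> R by rewrite ltr0n.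
have NC : N%:R != 0 :> C by rewrite pnatr_eq0 -lt0n.
rewrite (_ : _ - 1 = N%:R^-1 * \sum_(i < N)
   ((if (0 <= i%:Z - q.2 < N%:Z) then phi (tw (- i%:Z) q.1) else 0) - 1)).
  rewrite normrM ger0_norm ?invr_ge0 ?ler0n// mulrC ler_pdivrMr ?ltr0n//.
  apply: le_trans (ler_norm_sum _ _ _) _.
  (* Translation by [q.2] moves [i] out of the Folner set only within [m] of one end; counting both
     ends, whatever the sign of [q.2], gives the factor 2. *)
  apply: le_trans (_ : \sum_(i < N) (e + (i < m)%:R + (rev_ord i < m)%:R)%:C%C <= _).
    apply: ler_sum => i _; case: (boolP (0 <= i%:Z - q.2 < N%:Z)) => h.
      by apply: le_trans (near i) _; rewrite /= lecR -addrA lerDl addr_ge0 ?ler0n.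
    rewrite /= sub0r normrN1 -[1](rmorph1 (real_complex R)) lecR -addrA.
    apply: ler_wpDl; first exact: ltW.
    rewrite -natrD ler1n /=; move: h (ltn_ord i); lia.
  have revE : \sum_(i < N) (rev_ord i < m)%:R = \sum_(i < N) (i < m)%:R :> R.
    by rewrite [RHS](reindex_inj rev_ord_inj).
  rewrite -rmorph_sum complex_natr -rmorphM lecR !big_split {}revE /= sumr_const card_ord.
  rewrite -natr_sum mulrDl divfK ?gt_eqF// (mulr_natr e) -addrA lerD2l.
  by rewrite mulrDl mul1r lerD// ler_nat sum_ltn_le.
rewrite sumrB sumr_const card_ord mulrBr mulVf//; congr (_ * _ - _).
apply: eq_bigr => i _; rewrite -(sum_ord_shift N i q.2); apply: eq_bigr => j _.
by rewrite /= !addr0 invg1 mul1g.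
Qed.

(** Such a [kappa] is a normalized left-invariant kernel on [Gamma x| Z] vanishing at infinity; the
    group law is written out instead of forming this group. *)
Definition twisted_kernel_axioms (kappa : Gamma * int -> Gamma * int -> C) : Prop :=
  [/\ pdkernel kappa, forall p, kappa p p = 1,
      forall b c p q, kappa (b * tw c p.1, c + p.2)%g (b * tw c q.1, c + q.2)%g = kappa p q
    & forall eps : R, 0 < eps -> finite_set [set q | eps%:C%C <= `|kappa (1%g, 0) q|]].

Lemma twisted_kernel_ex : approximable R Gamma ->
  forall (F : seq (Gamma * int)) (e : R), 0 < e ->
  exists2 kappa, twisted_kernel_axioms kappa &
    forall q, q \in F -> `|kappa (1%g, 0) q - 1| <= e%:C%C.
Proof.
move=> ap F e e0; pose M := (\max_(q <- F) `|q.2|)%N.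
(* As [N > 4 M / e], the Folner error is at most [e / 2]. [N] is fixed before [phi], which has to be
   near 1 on [N] twists of each [q.1]. *)
pose N := (Num.truncn (4 * M%:R / e)).+1.
have e20 : 0 < e / 2 by lra.
have [phi [pd van phi1 near]] :=
  ap (flatten [seq [seq tw (- i%:Z) q.1 | i <- iota 0 N] | q <- F]) (e / 2) e20.
exists (folner_kernel phi N).
  split.
  - exact: folner_kernel_pd.
  - by move=> p; apply: folner_kernel_diag.
  - by move=> *; apply: folner_kernel_inv.
  - by move=> eps; apply: folner_kernel_fin.
move=> q qF; apply: le_trans (folner_kernel_near1 (e := e / 2) _ _ _) _ => //.
  move=> i; apply/ltW/near/flattenP; exists [seq tw (- i%:Z) q.1 | i <- iota 0 N].
    by apply/mapP; exists q.
  by apply/mapP; exists (val i) => //; rewrite mem_iota ltn_ord.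
rewrite lecR.
have : 2 * `|q.2|%N%:R / N%:R <= e / 2.
  rewrite ler_pdivrMr ?ltr0n//.
  have qM : `|q.2|%N%:R <= M%:R :> R by rewrite ler_nat /M (big_rem q)//= leq_maxl.
  have : 4 * M%:R / e <= N%:R by apply/ltW/truncnS_gt.
  rewrite ler_pdivrMr//; move: (N%:R : R) (M%:R : R) (_%:R : R) qM => u v w; nra.
by lra.
Qed.
End Folner.

(** * Affine maps between standard intervals and k-adic depth *)

Section Local.
Variables (R : realType) (k r : nat) (hk : (1 < k)%N).
Local Notation K := (k%:R : R).
Local Notation hoitv := (hoitv R r).
Local Notation V := (higman_thompson R r hk).
Local Notation Q := (kadic_point R k r).
Local Notation klo := (@klo R k).
Local Notation kitv := (@kitv R k).
Local Notation kaffine := (@kaffine R k).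
Local Notation kstd := (kstd k r).

Lemma K_gt0 : 0 < K. Proof. by rewrite ltr0n ltnW. Qed.
Lemma Kn_gt0 n : 0 < K ^+ n. Proof. by rewrite exprn_gt0 ?K_gt0. Qed.
Lemma Kn_neq0 n : K ^+ n != 0. Proof. by rewrite gt_eqF ?Kn_gt0. Qed.

Definition ksub (p s : nat * nat) : nat * nat := (p.1 + s.1, p.2 * k ^ s.1 + s.2)%N.

Definition affine_on (v : hoitv -> hoitv) (p q : nat * nat) : Prop :=
  forall x : hoitv, kitv p x -> v x = kaffine p q x :> R.

Lemma affine_on_sub v p q s : (s.2 < k ^ s.1)%N -> affine_on v p q ->
  affine_on v (ksub p s) (ksub q s).
Proof. by move=> h vpq x /(kitv_sub hk h) /vpq ->; rewrite kaffine_sub. Qed.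

Lemma ht_affine_on (v : V) :
  exists n, forall p, kstd p -> (n <= p.1)%N -> exists2 q, kstd q & affine_on v p q.
Proof. exact: ht_deep (htP v). Qed.

Lemma affine_on_in v p q (x : hoitv) : affine_on v p q -> kitv p x -> kitv q (v x).
Proof. by move=> vpq px; rewrite (vpq _ px); apply: kaffine_in. Qed.

Lemma affine_on_comp v w p q s : affine_on v p q -> affine_on w q s -> affine_on (w \o v) p s.
Proof.
move=> vpq wqs x px; have qx := affine_on_in vpq px.
by rewrite /= (wqs _ qx) (vpq _ px) kaffine_comp.
Qed.

Lemma affine_on_inv (v : V) p q (y : hoitv) : kstd p -> affine_on v p q -> kitv q y ->
  kitv p ((v^-1)%g y).
Proof.
move=> ps vpq qy; have py := kaffine_in hk p qy.
have [x xE] := hoitv_of hk ps py; rewrite -xE in py.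
have vx : v x = y by apply/val_inj; rewrite /= (vpq _ py) xE kaffineK.
by rewrite -vx (selfbijK v x : (v^-1)%g (v x) = x).
Qed.

Lemma affine_onV (v : V) p q : kstd p -> affine_on v p q -> affine_on (v^-1)%g q p.
Proof.
move=> ps vpq y qy; have px := affine_on_inv ps vpq qy.
have : y = v ((v^-1)%g y) :> R by rewrite (selfbijVK v y : v ((v^-1)%g y) = y).
by rewrite (vpq _ px) => /(congr1 (kaffine q p)); rewrite kaffineK.
Qed.

Lemma logderiv_affine_on v p q (x : hoitv) : kitv p x -> affine_on v p q ->
  logderiv k v x = p.1%:Z - q.1%:Z.
Proof.
move=> px vpq; rewrite /logderiv (@right_derivative_slope R k r v x (p.1%:Z - q.1%:Z)).
  by rewrite logk_exp.
have := px; rewrite /kitv /= in_itv /= => /andP[lx xh].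
exists (khi R k p - (x : R)); first by rewrite subr_gt0.
move=> y; rewrite addrC subrK => /andP[xy yh].
have py : kitv p y by rewrite /kitv /= in_itv /= yh (le_trans lx).
rewrite (vpq _ py) (vpq _ px) !kaffineE expfzDr ?gt_eqF ?K_gt0// -exprnN -exprnP; ring.
Qed.

(** The slope, read off from the logarithmic derivative at the left endpoint, fixes the depth of the
    image. *)
Lemma affine_on_depth v p q q' : kstd p -> affine_on v p q -> affine_on v p q' -> q.1 = q'.1.
Proof.
move=> ps vq vq'; have px := klo_in R hk p.
have [x xE] := hoitv_of hk ps px; rewrite -xE in px.
have := logderiv_affine_on px vq; rewrite (logderiv_affine_on px vq').
by move=> /addrI/oppr_inj[].
Qed.

Lemma affine_on_id p q : kstd p -> affine_on id p q -> p = q.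
Proof.
move=> ps aff; have px := klo_in R hk p.
have [x xE] := hoitv_of hk ps px; rewrite -xE in px.
apply: (kitv_depth hk px (affine_on_in aff px)).
apply: affine_on_depth ps _ aff => y _.
by apply: kaffine_uniq.
Qed.

(** * The k-adic depth of a point *)

Lemma kaffine_klo p q : kaffine p q (klo p) = klo q.
Proof. by rewrite /kaffine subrr mulr0 addr0. Qed.

Lemma kitv_int p x : kitv p x -> x * K ^+ p.1 \is a Num.int -> x = klo p.
Proof.
move=> /(kitvE hk)/andP[h1 h2] /intrP[m mE]; apply: (mulIf (Kn_neq0 p.1)).
move: h1 h2; rewrite mE /klo divfK ?Kn_neq0//.
rewrite !(pmulrn 1) ler_int ltr_int => h1 h2.
by congr (_%:~R); apply/eqP; rewrite eq_le h1 andbT -ltzD1; move: h2; lia.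
Qed.

Lemma kadic_depth_ex (x : Q) : exists n, (x : R) * K ^+ n \is a Num.int.
Proof.
by have [a [n ->]] := kadicP x; exists n; rewrite divfK ?Kn_neq0// intr_int.
Qed.

(** Its coboundary is what untwists [log_k v'], see [depth_cocycle]. *)
Definition kdepth (x : Q) : nat := ex_minn (kadic_depth_ex x).

Lemma kdepthP (x : Q) n : ((x : R) * K ^+ n \is a Num.int) = (kdepth x <= n)%N.
Proof.
rewrite /kdepth; case: ex_minnP => m xm mn; apply/idP/idP => [/mn//|mn'].
by rewrite -(subnKC mn') exprD mulrA rpredM// rpredX// natr_int.
Qed.

Lemma kdepth_klo (x : Q) p : kitv p x -> (kdepth x <= p.1)%N -> x = klo p :> R.
Proof. by move=> px; rewrite -kdepthP; apply: kitv_int. Qed.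

(** The numbers [v x * k^q.1] and [x * k^p.1] differ by an integer, and a factor
    [k^(kdepth x - p.1)] makes the latter integral. Off the left endpoint [p.1 <= kdepth x], so this
    exponent is not truncated. *)
Lemma kdepth_le v p q (x y : Q) : kitv p x -> (x : R) <> klo p ->
  affine_on v p q -> v x = y -> (kdepth y - q.1 <= kdepth x - p.1)%N.
Proof.
move=> px nx vpq vx; rewrite leq_subLR -kdepthP.
have lt : (p.1 <= kdepth x)%N.
  by rewrite leqNgt; apply/negP => /ltnW /(kdepth_klo px).
have := kaffine_scale hk p q x; rewrite -(vpq _ px) vx => /eqP; rewrite subr_eq => /eqP e.
rewrite exprD mulrA e mulrDl rpredD//; last by rewrite rpredM ?rpredX// natr_int.
rewrite mulrBl rpredB//; last by rewrite rpredM ?rpredX// natr_int.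
by rewrite -mulrA -exprD subnKC// kdepthP.
Qed.

(** Apply [kdepth_le] to [v] and to its inverse; neither point is a left endpoint, so the natural
    subtractions are exact. *)
Lemma kdepth_affine (v : V) p q (x : Q) : kstd p -> kitv p x -> (x : R) <> klo p ->
  affine_on v p q ->
  (kdepth (kadic_act v x))%:Z - q.1%:Z = (kdepth x)%:Z - p.1%:Z.
Proof.
move=> ps px nx vpq; set y := kadic_act v x.
have qy : kitv q y := affine_on_in vpq px.
have xE : (v^-1)%g (y : hoitv) = x := selfbijK v x.
have ny : (y : R) <> klo q.
  move=> e; apply: nx; have := affine_onV ps vpq qy.
  by rewrite xE e kaffine_klo.
have h1 := kdepth_le px nx vpq erefl (y := y).
have h2 := kdepth_le qy ny (affine_onV ps vpq) xE.
have l1 : (p.1 <= kdepth x)%N by rewrite leqNgt; apply/negP => /ltnW /(kdepth_klo px).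
have l2 : (q.1 <= kdepth y)%N by rewrite leqNgt; apply/negP => /ltnW /(kdepth_klo qy).
lia.
Qed.

End Local.

(** * The zipper action *)

Section Zipper.
Variables (R : realType) (Gamma : groupType) (theta : autG Gamma).
Variables (k r : nat) (hk : (1 < k)%N).
Local Notation V := (higman_thompson R r hk).
Local Notation Q := (kadic_point R k r).
Local Notation G := (twisted_wreath R theta r hk).
Local Notation klo := (@klo R k).
Local Notation kitv := (@kitv R k).
Local Notation kaffine := (@kaffine R k).
Local Notation kstd := (kstd k r).
Local Notation tw := (expgz theta).
Implicit Types (g h l : G) (p q s : nat * nat).

(** * Nice elements on standard intervals *)

Definition lab g : Q -> Gamma := (g.1 : direct_sum Q Gamma).
Definition ht g : V := g.2.

Lemma htM g h : ht (g * h)%g = (ht g * ht h)%g. Proof. by []. Qed.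
Lemma htV g : ht g^-1%g = (ht g)^-1%g. Proof. by []. Qed.
Lemma ht1 : ht 1%g = 1%g. Proof. by []. Qed.
Lemma lab1 x : lab 1%g x = 1%g. Proof. exact: dsum_oneE. Qed.
Lemma labM g h x : lab (g * h)%g (kadic_act (ht g) x) =
  (lab g (kadic_act (ht g) x) * tw (logderiv k (ht g) x) (lab h x))%g.
Proof.
rewrite /lab [(g * h)%g.1]/(g.1 * twist_fun theta (ht g) h.1)%g dsumM twist_funE.
by rewrite kadic_actK.
Qed.

Definition nice g p q : Prop :=
  [/\ kstd p, kstd q, affine_on k (ht g) p q &
      forall x : Q, kitv p x -> (x : R) <> klo p -> lab g (kadic_act (ht g) x) = 1%g].

Lemma nice1 p : kstd p -> nice 1%g p p.
Proof.
by move=> ps; split=> // [x px|x _ _]; [exact: kaffine_uniq|rewrite lab1].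
Qed.

Lemma nice1_eq p q : nice 1%g p q -> p = q.
Proof. by move=> [ps qs aff _]; apply: (@affine_on_id R k r hk p q ps aff). Qed.

(** Affine maps match left endpoints, so the exceptional point in [nice] is preserved under
    composition. *)
Lemma nice_act g p q (x : Q) : nice g p q -> kitv p x -> (x : R) <> klo p ->
  kitv q (kadic_act (ht g) x) /\ (kadic_act (ht g) x : R) <> klo q.
Proof.
move=> [ps qs aff _] px nx; have qx := affine_on_in hk aff px; split=> // e.
apply: nx; have := aff _ px; rewrite -[LHS]/(kadic_act (ht g) x : R) e.
by move=> /(congr1 (kaffine q p)); rewrite kaffineK// kaffine_klo.
Qed.

Lemma niceM g h p q s : nice g p q -> nice h q s -> nice (h * g)%g p s.
Proof.
move=> gpq hqs; have [ps qs ga gl] := gpq; have [_ ss ha hl] := hqs.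
split=> // [|x px nx]; first exact: (affine_on_comp hk ga ha).
have [qx nx'] := nice_act gpq px nx.
by rewrite htM kadic_actM labM gl// autG_fix1 hl// mulg1.
Qed.

Lemma niceV g p q : nice g p q -> nice g^-1%g q p.
Proof.
move=> gpq; have [ps qs ga gl] := gpq; have ga' := affine_onV ps ga.
split=> // y qy ny; rewrite htV; set x := kadic_act _ y.
have px : kitv p x := affine_on_in hk ga' qy.
have xy : kadic_act (ht g) x = y by rewrite /x kadic_actVK.
have nx : (x : R) <> klo p.
  move=> e; apply: ny; rewrite -xy; have := ga _ px; rewrite e kaffine_klo.
  by [].
have ly : lab g y = 1%g by rewrite -xy gl.
by have := labM g^-1%g g y; rewrite mulVg lab1 htV -/x ly autG_fix1 mulg1 => <-.
Qed.

Lemma nice_depth g p q q' : nice g p q -> nice g p q' -> q.1 = q'.1.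
Proof. by move=> [ps _ ga _] [_ _ ga' _]; exact: (@affine_on_depth R k r hk _ _ _ _ ps ga ga'). Qed.

Lemma nice_sub g p q s : (s.2 < k ^ s.1)%N -> nice g p q -> nice g (ksub k p s) (ksub k q s).
Proof.
move=> sk [ps qs ga gl]; split; [exact: kstd_sub|exact: kstd_sub|exact: affine_on_sub|].
move=> x px nx; have px' := kitv_sub hk sk px; apply: gl => // e.
(* If the left endpoint of [p] lies in the subinterval, it is also the left endpoint of the
   subinterval. *)
apply: nx; rewrite e; apply/eqP; rewrite eq_le; apply/andP; split.
  have := klo_in R hk (ksub k p s) => /(kitv_sub hk sk).
  by rewrite /kitv /= in_itv /= => /andP[].
by move: px; rewrite /kitv /= in_itv /= e => /andP[].
Qed.

Lemma nice_deep g : exists n, forall p, kstd p -> (n <= p.1)%N -> exists q, nice g p q.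
Proof.
have [n nP] := ht_affine_on (ht g).
(* In an interval of depth at least [m], the preimage of a support point can only be the left
   endpoint. *)
pose m := (\max_(y <- finsupp (g.1 : direct_sum Q Gamma)) kdepth hk (kadic_act (ht g)^-1%g y))%N.
exists (maxn n m) => p ps; rewrite geq_max => /andP[np mp].
have [q qs ga] := nP p ps np; exists q; split=> // x px nx.
apply: dsum_out; apply/negP => xs; apply: nx; apply: (kdepth_klo (hk := hk) px).
apply: leq_trans mp; rewrite /m (big_rem _ xs) /= kadic_actK.
exact: leq_maxl.
Qed.

(** The class of [(g, p)] is kept as a set of pairs, so that no quotient is formed; [niceM] and
    [niceV] make the relation transitive and symmetric. *)
Definition cell g p : set (G * (nat * nat)) := [set hq | nice (hq.1^-1 * g)%g p hq.2].

Lemma cell_eq g h p q : nice (h^-1 * g)%g p q -> cell g p = cell h q.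
Proof.
move=> n; rewrite /cell; apply/seteqP; split=> -[l s] /= ls.
  have -> : (l^-1 * h = l^-1 * g * (h^-1 * g)^-1)%g by rewrite invgM invgK mulgA mulgK.
  exact: niceM (niceV n) ls.
have -> : (l^-1 * g = l^-1 * h * (h^-1 * g))%g by rewrite -!mulgA mulVKg.
exact: niceM n ls.
Qed.

Lemma cell_nice g h p q : kstd q -> cell g p = cell h q -> nice (h^-1 * g)%g p q.
Proof.
move=> qs e; have : cell h q (h, q) by rewrite /cell /= mulVg; exact: nice1.
by rewrite -e.
Qed.

Definition cells g : set (set (G * (nat * nat))) := [set cell g p | p in kstd].

(** This is left translation on first components, defined on all sets of pairs so that it is a
    bijection of a whole type, as [positive_definite_prod] requires. *)
Definition cell_shift l (z : set (G * (nat * nat))) : set (G * (nat * nat)) :=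
  [set hq | z (l^-1 * hq.1, hq.2)%g].

Lemma cell_shiftK l : cancel (cell_shift l) (cell_shift l^-1%g).
Proof.
move=> z; apply/seteqP; split=> -[h q]; rewrite /cell_shift /= invgK mulKg//.
Qed.

Lemma cell_shift_bij l : bijective (cell_shift l).
Proof.
exists (cell_shift l^-1%g); first exact: cell_shiftK.
by have := @cell_shiftK l^-1%g; rewrite invgK.
Qed.

Lemma cell_shiftE l g p : cell_shift l (cell g p) = cell (l * g)%g p.
Proof.
by apply/seteqP; split=> -[h q]; rewrite /cell_shift /cell /= invgM invgK mulgA.
Qed.

Lemma cells_shift l g z : cells (l * g)%g (cell_shift l z) <-> cells g z.
Proof.
split=> -[p ps e]; exists p => //; last by rewrite -e cell_shiftE.
by apply: (bij_inj (cell_shift_bij l)); rewrite -e cell_shiftE.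
Qed.

Lemma cellsP g h p : kstd p -> cells h (cell g p) <-> exists q, nice (h^-1 * g)%g p q.
Proof.
move=> ps; split=> [[q qs e]|[q n]].
  by exists q; apply: cell_nice.
by exists q; [case: n|rewrite (cell_eq n)].
Qed.

(** By [nice_deep] only classes of the finitely many intervals of depth below [n] can be missing
    from [cells h]. *)
Lemma cells_diff_fin g h : finite_set (cells g `\` cells h).
Proof.
have [n nP] := nice_deep (h^-1 * g)%g.
apply: (@sub_finite_set _ _ ((fun p : 'I_n * 'I_(r * k ^ n) => cell g (val p.1, val p.2)) @` setT)); last first.
  exact/finite_image/finite_finset.
move=> _ [[p ps <-] np].
have pn : (p.1 < n)%N.
  by rewrite ltnNge; apply/negP => /(nP _ ps)/(cellsP _ _ ps).
have pr : (p.2 < r * k ^ n)%N.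
  by apply: leq_trans ps _; rewrite leq_mul2l leq_pexp2l ?orbT ?(ltnW hk)// ltnW.
by exists (Ordinal pn, Ordinal pr) => //=; case: (p).
Qed.

(** * The zipper length and its positive definite function *)

Definition cells_sdiff g h := (cells g `\` cells h) `|` (cells h `\` cells g).

Lemma cells_sdiff_fin g h : finite_set (cells_sdiff g h).
Proof. by rewrite finite_setU; split; exact: cells_diff_fin. Qed.

Definition zlength g : nat := #|` fset_set (cells_sdiff 1%g g)|.

(** Each class separating [g] from [h] contributes one factor [t], so the product over all [z] is a
    power of [t]. *)
Definition zipper_kernel (t : R) (z : set (G * (nat * nat))) g h : R[i] :=
  if `[< cells g z >] == `[< cells h z >] then 1 else t%:C%C.

(** The kernel is the convex combination, with weights [t] and [1 - t], of the constant 1 and the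
    equality kernel of membership. *)
Lemma zipper_kernel_pd (t : R) z : 0 <= t <= 1 -> pdkernel (zipper_kernel t z).
Proof.
move=> /andP[t0 t1]; pose b g := `[< cells g z >].
have p1 : pdkernel (fun _ _ : G => t%:C%C : R[i]) by apply: pdkernel_cst; rewrite ler0c.
have p2 : pdkernel (fun _ _ : G => (1 - t)%:C%C : R[i]).
  by apply: pdkernel_cst; rewrite ler0c subr_ge0.
have := pdkernelD p1 (pdkernelM p2 (pdkernel_pull b (@pdkernel_eq _ bool))).
apply: eq_pdkernel => g h; rewrite /zipper_kernel /b; case: eqVneq => _.
  by rewrite mulr1 rmorphB /= rmorph1 addrC subrK.
by rewrite mulr0 addr0.
Qed.

Lemma zipper_kernel_neq1 t z g h : zipper_kernel t z g h <> 1 -> cells_sdiff g h z.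
Proof.
rewrite /zipper_kernel; case: asboolP; case: asboolP => //=; rewrite ?eqxx//.
  by move=> ? ? _; left.
by move=> ? ? _; right.
Qed.

Definition zipper_fun t g : R[i] := \big[*%R/1]_(z \in setT) zipper_kernel t z 1%g g.

Lemma zipper_fun_pd (t : R) : 0 <= t <= 1 -> positive_definite (zipper_fun t).
Proof.
move=> t01; apply: (@positive_definite_prod R G _ cell_shift (zipper_kernel t)).
- exact: cell_shift_bij.
- move=> l z g h; rewrite /zipper_kernel.
  by rewrite (asbool_equiv_eq (cells_shift l g z)) (asbool_equiv_eq (cells_shift l h z)).
- by move=> z; apply: zipper_kernel_pd.
- move=> g h; apply: sub_finite_set (cells_sdiff_fin g h) => z.
  exact: zipper_kernel_neq1.
Qed.

Lemma zipper_funE t g : zipper_fun t g = (t ^+ zlength g)%:C%C.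
Proof.
rewrite /zipper_fun (fsbigTE (fset_set (cells_sdiff 1%g g))); last first.
  move=> z; rewrite in_fset_set; last exact: cells_sdiff_fin.
  by move=> /negP zn; apply: contrapT => /zipper_kernel_neq1 h; apply: zn; apply/mem_set.
rewrite (eq_big_seq (fun=> t%:C%C)) => [|z]; last first.
  rewrite in_fset_set ?inE; last exact: cells_sdiff_fin.
  rewrite /zipper_kernel => -[[z1 zg]|[zg z1]]; first by rewrite (asboolT z1) (asboolF zg).
  by rewrite (asboolF z1) (asboolT zg).
by rewrite big_const_seq count_predT /= -Monoid.iteropE /= rmorphXn.
Qed.

(** Niceness passes to subintervals, so if it fails on [p] it fails on the [p.1 + 1] intervals
    [anc j] containing [p]. Their classes all lie in the difference, and are distinct because
    [nice 1] relates only equal intervals. *)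
Lemma cells_diff_depth g h p (D : {fset set (G * (nat * nat))}) : kstd p ->
  ~ (exists q, nice (h^-1 * g)%g p q) ->
  (forall z, (cells g `\` cells h) z -> z \in D) -> (p.1 < #|` D|)%N.
Proof.
move=> ps np Dz.
pose anc j := (j, p.2 %/ k ^ (p.1 - j))%N.
have ancP j : (j <= p.1)%N -> kstd (anc j) /\ ~ exists q, nice (h^-1 * g)%g (anc j) q.
  move=> jp; have k0 : (0 < k)%N by apply: ltnW.
  have as_ : kstd (anc j).
    by rewrite /Defs.kstd /= ltn_divLR ?expn_gt0 ?k0// -mulnA -expnD subnKC.
  split=> // -[q n]; apply: np; exists (ksub k q (p.1 - j, p.2 %% k ^ (p.1 - j)))%N.
  have := @nice_sub _ _ _ (p.1 - j, p.2 %% k ^ (p.1 - j))%N _ n; rewrite /= ltn_mod expn_gt0 k0.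
  move=> /(_ isT); congr nice.
  by rewrite /ksub /= subnKC// -divn_eq; case: (p).
have uq : uniq [seq cell g (anc j) | j <- iota 0 p.1.+1].
  rewrite map_inj_in_uniq ?iota_uniq// => i j; rewrite !mem_iota !add0n !ltnS => /= ip jp.
  have [js _] := ancP j jp => /(cell_nice js).
  by rewrite mulVg => /nice1_eq[].
suff sub : {subset [seq cell g (anc j) | j <- iota 0 p.1.+1] <= (D : seq _)}.
  by have := uniq_leq_size uq sub; rewrite size_map size_iota.
move=> z /mapP[j]; rewrite mem_iota ltnS => /= jp ->; apply: Dz.
by have [js nj] := ancP j jp; split; [exists (anc j)|move/(cellsP g h js)].
Qed.

Lemma zlength_nice g p : kstd p -> (zlength g <= p.1)%N -> exists q, nice g p q.
Proof.
move=> ps gp; apply: contrapT => np.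
have := @cells_diff_depth g 1%g p (fset_set (cells_sdiff 1%g g)) ps; rewrite invg1 mul1g.
rewrite -/(zlength g) ltnNge gp => /(_ np) h; suff: false by []; apply: h => z zD.
rewrite in_fset_set; last exact: cells_sdiff_fin.
by apply/mem_set; right.
Qed.

(** The length counts both halves of the symmetric difference, so it controls the inverse too. *)
Lemma zlength_niceV g p : kstd p -> (zlength g <= p.1)%N -> exists q, nice g^-1%g p q.
Proof.
move=> ps gp; apply: contrapT => np.
have := @cells_diff_depth 1%g g p (fset_set (cells_sdiff 1%g g)) ps; rewrite mulg1.
rewrite -/(zlength g) ltnNge gp => /(_ np) h; suff: false by []; apply: h => z zD.
rewrite in_fset_set; last exact: cells_sdiff_fin.
by apply/mem_set; left.
Qed.

(** If [q.1 > n], then [g^-1] is nice on the interval [q'] of depth [n] containing [q], with image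
    [p']. Comparing depths gives [p'.1 + (q.1 - n) = n]. *)
Lemma zlength_range g p q n : (zlength g <= n)%N -> p.1 = n -> nice g p q -> (q.1 <= n.*2)%N.
Proof.
move=> gn pn npq; have [ps qs _ _] := npq.
have [qn|nq] := leqP q.1 n; first by rewrite (leq_trans qn)// -addnn leq_addr.
have [q' [t [q'n tk tE q's qE]]] := ksub_ex hk (ltnW nq) qs.
have [p' np'] : exists p', nice g^-1%g q' p' by apply: zlength_niceV; rewrite ?q'n.
have h1 := nice_sub tk np'; have := niceV npq; rewrite qE => h2.
have := nice_depth h1 h2; rewrite /= pn tE -addnn; lia.
Qed.
End Zipper.

(** * Untwisting *)

(** A relation instead of a coding function spares its users from choosing a code for each
    element. *)
Lemma finite_set_coding (T U : Type) (D : set T) (E : set U) (rel : T -> U -> Prop) :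
  finite_set E -> (forall t, D t -> exists2 c, E c & rel t c) ->
  (forall t t' c, D t -> D t' -> rel t c -> rel t' c -> t = t') -> finite_set D.
Proof.
move=> Efin ex uniq; have [t0|D0] := pselect (exists t, D t); last first.
  by rewrite (_ : D = set0) ?finite_set0//; apply/seteqP; split=> // t Dt; apply: D0; exists t.
have /choice[f fP] : forall c, exists t, (exists2 t, D t & rel t c) -> D t /\ rel t c.
  move=> c; have [[t Dt tc]|n] := pselect (exists2 t, D t & rel t c); first by exists t.
  by case: t0 => t _; exists t => /n.
apply: sub_finite_set (finite_image f Efin) => t Dt.
have [c Ec tc] := ex t Dt; exists c => //.
have [|Df fc] := fP c; first by exists t.
exact: (uniq _ _ c).
Qed.

Lemma prod_near1 (R : realType) (I : eqType) (r : seq I) (f : I -> R[i]) (e : R[i]) :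
  (forall i, `|f i| <= 1) -> (forall i, i \in r -> `|f i - 1| <= e) ->
  `|\prod_(i <- r) f i - 1| <= e *+ size r.
Proof.
move=> f1; elim: r => [|i r IHr] fe; first by rewrite big_nil subrr normr0 mulr0n.
rewrite big_cons /= mulrS.
rewrite (_ : _ - 1 = (f i - 1) + f i * (\prod_(j <- r) f j - 1)); last by ring.
apply: le_trans (ler_normD _ _) _; apply: lerD; first by apply: fe; rewrite mem_head.
rewrite normrM; apply: le_trans (ler_piMl _ (f1 i)) _ => //.
by apply: IHr => j jr; apply: fe; rewrite inE jr orbT.
Qed.

Lemma prod_norm_le1 (R : realType) (I : Type) (r : seq I) (f : I -> R[i]) :
  (forall i, `|f i| <= 1) -> `|\prod_(i <- r) f i| <= 1.
Proof.
move=> f1; elim: r => [|i r IHr]; first by rewrite big_nil normr1.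
by rewrite big_cons normrM mulr_ile1.
Qed.

Section Untwisting.
Variables (R : realType) (Gamma : groupType) (theta : autG Gamma).
Variables (k r : nat) (hk : (1 < k)%N).
Local Notation V := (higman_thompson R r hk).
Local Notation Q := (kadic_point R k r).
Local Notation G := (twisted_wreath R theta r hk).
Local Notation klo := (@klo R k).
Local Notation kitv := (@kitv R k).
Local Notation kstd := (kstd k r).
Local Notation tw := (expgz theta).
Implicit Types (g h l : G) (x y : Q) (v w : V).

(** The argument is the image point [x = v y]: the coboundary of the depth is added to [log_k v'] at
    [y]. *)
Definition depth_cocycle v x : int :=
  let y := kadic_act v^-1%g x in
  (kdepth hk x)%:Z - (kdepth hk y)%:Z + logderiv k v y.

Lemma depth_cocycle_act v x : depth_cocycle v (kadic_act v x) =
  (kdepth hk (kadic_act v x))%:Z - (kdepth hk x)%:Z + logderiv k v x.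
Proof. by rewrite /depth_cocycle kadic_actK. Qed.

Lemma depth_cocycle1 x : depth_cocycle 1%g x = 0.
Proof.
rewrite -{1}[x](kadic_act1 hk) depth_cocycle_act kadic_act1 subrr add0r.
exact: logderiv1.
Qed.

Lemma depth_cocycleM v w x : depth_cocycle (v * w)%g (kadic_act v x) =
  depth_cocycle v (kadic_act v x) + depth_cocycle w x.
Proof.
have -> : x = kadic_act w (kadic_act w^-1%g x) by rewrite kadic_actVK.
move: (kadic_act _ x) => {}x.
rewrite -kadic_actM !depth_cocycle_act kadic_actM depth_cocycle_act.
rewrite (logderivM hk _ (htP v) (htP w)).
rewrite -[ht_bij w (kadic_val _)]/(kadic_val (kadic_act w _)).
ring.
Qed.

(** On an interval where [v] is affine, [kdepth_affine] cancels the logarithmic derivative off the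
    left endpoint. So the support is coded by the left endpoints of depth [n]. *)
Lemma depth_cocycle_fin v : finite_set [set x | depth_cocycle v x <> 0].
Proof.
have [n nP] := ht_affine_on v.
pose rel x (i : 'I_(r * k ^ n)) := (kadic_act v^-1%g x : R) = klo (n, i : nat).
apply: (@finite_set_coding _ _ _ [set: 'I_(r * k ^ n)] rel).
- exact: finite_finset.
- move=> x cx; have [y xE] : exists y, x = kadic_act v y.
    by exists (kadic_act v^-1%g x); rewrite kadic_actVK.
  rewrite {}xE in cx *.
  have [[m a] [/= mn ps px]] := kitv_ex hk (y : hoitv R r) n; subst m.
  exists (Ordinal (ps : (a < r * k ^ n)%N)) => //; rewrite /rel kadic_actK.
  have [q qs vq] := nP _ ps (leqnn _).
  apply: contrapT => ny; apply: cx; rewrite depth_cocycle_act.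
  have := kdepth_affine ps px ny vq.
  rewrite (@logderiv_affine_on R k r hk v _ _ (kadic_val y) px vq) /=.
  lia.
- move=> x x' i _ _ h h'; rewrite -[x](kadic_actVK v) -[x'](kadic_actVK v).
  by congr kadic_act; do 2 apply/val_inj; rewrite /= [LHS]h [RHS]h'.
Qed.

(* The embedding of [g] in the untwisted wreath product of [Gamma x| Z], at [x];
   see [untwistM]. *)
Definition untwist g x : Gamma * int :=
  (tw (kdepth hk x)%:Z (lab g x), depth_cocycle (ht g) x).

Lemma untwist1 x : untwist 1%g x = (1%g, 0).
Proof. by rewrite /untwist lab1 autG_fix1 ht1 depth_cocycle1. Qed.

(** The twist by [log_k v'] followed by that of the depth at [y] equals the twist of the depth at
    [x] followed by [depth_cocycle]; so the law is that of [Gamma x| Z] at each point. *)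
Lemma untwistM l g x (y := kadic_act (ht l) x) : untwist (l * g)%g y =
  ((untwist l y).1 * tw (untwist l y).2 (untwist g x).1, (untwist l y).2 + (untwist g x).2)%g.
Proof.
rewrite /untwist /y htM depth_cocycleM labM autG_morph; congr (_ * _, _)%g.
rewrite -[RHS]/(tw (depth_cocycle (ht l) y) (tw (kdepth hk x)%:Z (lab g x))) -!twD.
by rewrite depth_cocycle_act; congr (tw _ _); ring.
Qed.

Lemma untwist_fin g : finite_set [set x | untwist g x <> (1%g, 0)].
Proof.
apply: (@sub_finite_set _ _ ([set` finsupp (g.1 : direct_sum Q Gamma)] `|`
   [set x | depth_cocycle (ht g) x <> 0])).
  move=> x; rewrite /untwist /= => nx; apply: contrapT => /not_orP[/= /negP h1 /contrapT h2].
  by apply: nx; rewrite h2 [lab g x](dsum_out h1) autG_fix1.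
by rewrite finite_setU; split; [exact: finite_fset|exact: depth_cocycle_fin].
Qed.

(** * The product over all points of a kernel on the extension by the integers *)

Section Coefficient.
Variable kappa : Gamma * int -> Gamma * int -> R[i].
Hypothesis kappaP : twisted_kernel_axioms theta kappa.
Local Notation one := ((1%g, 0) : Gamma * int).

Lemma kappa_le1 p q : `|kappa p q| <= 1.
Proof. by have [pd diag _ _] := kappaP; apply: pdkernel_norm_le1. Qed.

Definition wreath_fun g : R[i] := \big[*%R/1]_(x \in setT) kappa one (untwist g x).

Lemma wreath_fun_pd : positive_definite wreath_fun.
Proof.
have [pd diag inv _] := kappaP.
have := @positive_definite_prod R G Q (fun l => kadic_act (ht l))
  (fun x g h => kappa (untwist g x) (untwist h x)).
rewrite (_ : wreath_fun = fun g : G =>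
  \big[*%R/1]_(x \in [set: Q]) kappa (untwist 1%g x) (untwist g x)); last first.
  by apply/funext => g; apply: eq_fsbigr => x _; rewrite untwist1.
apply.
- by move=> l; exists (kadic_act (ht l)^-1%g); [exact: kadic_actK|exact: kadic_actVK].
- by move=> l x g h; rewrite !untwistM inv.
- by move=> x; apply: (pdkernel_pull (fun g => untwist g x)).
- move=> g h; apply: (@sub_finite_set _ _ ([set x | untwist g x <> one] `|` [set x | untwist h x <> one])).
    move=> x /= nx; apply: contrapT => /not_orP[/= /contrapT h1 /contrapT h2].
    by apply: nx; rewrite h1 h2 diag.
  by rewrite finite_setU; split; exact: untwist_fin.
Qed.

Definition untwist_supp g : {fset Q} := fset_set [set x | untwist g x <> one].

Lemma wreath_funE g (A : {fset Q}) : {subset untwist_supp g <= A} ->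
  wreath_fun g = \prod_(x <- A) kappa one (untwist g x).
Proof.
have [_ diag _ _] := kappaP; move=> sub; apply: fsbigTE => x xA.
suff -> : untwist g x = one by [].
apply: contrapT => nx; move/negP: xA; apply; apply: sub.
by rewrite in_fset_set; [exact/mem_set|exact: untwist_fin].
Qed.

Lemma wreath_fun_le1 g : `|wreath_fun g| <= 1.
Proof. by rewrite (@wreath_funE g (untwist_supp g))// prod_norm_le1// => x; exact: kappa_le1. Qed.

(** All other factors have modulus at most 1. Hence a lower bound on the product bounds every single
    factor from below. *)
Lemma wreath_fun_le g x : `|wreath_fun g| <= `|kappa one (untwist g x)|.
Proof.
rewrite (@wreath_funE g (x |` untwist_supp g)%fset); last by move=> y; rewrite !inE orbC => ->.
rewrite (bigD1_seq x) ?fset_uniq//= ?inE ?eqxx// normrM ler_piMr//.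
rewrite -big_filter prod_norm_le1// => y; exact: kappa_le1.
Qed.

Lemma wreath_fun_near1 g (e : R[i]) :
  (forall x, x \in untwist_supp g -> `|kappa one (untwist g x) - 1| <= e) ->
  `|wreath_fun g - 1| <= e *+ #|` untwist_supp g|.
Proof.
move=> h; rewrite (@wreath_funE g (untwist_supp g))// prod_near1// => x; exact: kappa_le1.
Qed.

End Coefficient.
End Untwisting.

(** * The approximating functions *)

Lemma expr_lt_ex (R : realType) (t eps : R) : 0 <= t < 1 -> 0 < eps -> exists n, t ^+ n < eps.
Proof.
move=> /andP[t0 t1] eps0; have : `|t| < 1 by rewrite ger0_norm.
move=> /cvg_expr/cvgrPdist_lt/(_ eps eps0)[n _ nP]; exists n.
have := nP n (leqnn n); rewrite /= sub0r normrN ger0_norm ?exprn_ge0//.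
Qed.

Section Approximation.
Variables (R : realType) (Gamma : groupType) (theta : autG Gamma).
Variables (k r : nat) (hk : (1 < k)%N).
Local Notation Q := (kadic_point R k r).
Local Notation G := (twisted_wreath R theta r hk).
Local Notation klo := (@klo R k).
Local Notation kitv := (@kitv R k).
Local Notation kstd := (kstd k r).
Local Notation tw := (expgz theta).
Local Notation one := ((1%g, 0) : Gamma * int).
Implicit Types (g h : G) (x y : Q).

Lemma kadic_points_fin n :
  finite_set [set y : Q | exists q, [/\ kstd q, (q.1 <= n)%N & y = klo q :> R]].
Proof.
pose rel (y : Q) (c : 'I_n.+1 * 'I_(r * k ^ n)) := y = klo (c.1 : nat, c.2 : nat) :> R.
apply: (@finite_set_coding _ _ _ setT rel); first exact: finite_finset.
- move=> y [[m a] [/= qs qn yE]].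
  have an : (a < r * k ^ n)%N.
    by apply: leq_trans qs _; rewrite leq_mul2l leq_pexp2l ?orbT// ltnW.
  by exists (Ordinal (qn : (m < n.+1)%N), Ordinal an).
- by move=> y y' c _ _ h h'; do 2 apply/val_inj; rewrite /= [LHS]h [RHS]h'.
Qed.

(** The preimage of [y] lies in an interval of depth [n], where [g] is nice; a nontrivial label
    forces [y] to be the left endpoint of the image, whose depth is at most [2n]. *)
Lemma lab_supp g n y : (zlength g <= n)%N -> lab g y <> 1%g ->
  exists q, [/\ kstd q, (q.1 <= n.*2)%N & y = klo q :> R].
Proof.
move=> gn; rewrite -(kadic_actVK (ht g) y); move: (kadic_act _ y) => {}y ny.
have [p [pn ps py]] := kitv_ex hk (y : hoitv R r) n.
have [q npq] : exists q, nice g p q by apply: zlength_nice; rewrite ?pn.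
have [_ qs ga gl] := npq; exists q; split=> //; first exact: zlength_range gn pn npq.
apply: contrapT => nq; apply: ny; apply: gl => // yp.
by apply: nq; have := ga _ py; rewrite yp kaffine_klo.
Qed.

(** An element is coded by the images of the intervals of depth [n], which determine its bijection,
    and by its labels on the finite set [S], outside of which they are trivial. *)
Lemma proper_fin (n : nat) (W : set (Gamma * int)) : finite_set W ->
  finite_set [set g : G | (zlength g <= n)%N /\ forall x, W (untwist g x)].
Proof.
move=> Wfin; pose S := fset_set [set y : Q | exists q, [/\ kstd q, (q.1 <= n.*2)%N & y = klo q :> R]].
have SP y : y \in S <-> exists q, [/\ kstd q, (q.1 <= n.*2)%N & y = klo q :> R].
  rewrite in_fset_set; last exact: kadic_points_fin.
  by rewrite inE.
(* [T] contains the possible labels on [S], recovered from [W] by undoing the twist by the depth. *)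
pose T : set Gamma := \bigcup_(y in [set` S]) ((fun p => tw (- (kdepth hk y)%:Z) p.1) @` W).
have Tfin : finite_set T.
  by apply: bigcup_finite; [exact: finite_fset|move=> y _; exact: finite_image].
pose code := ({ffun 'I_(r * k ^ n) -> 'I_n.*2.+1 * 'I_(r * k ^ n.*2)}
              * {ffun S -> fset_set T})%type.
pose rel g (c : code) := (forall i : 'I_(r * k ^ n), nice g (n, i : nat) (val (c.1 i).1, val (c.1 i).2))
   /\ (forall y : S, lab g (val y) = val (c.2 y)).
apply: (@finite_set_coding _ _ _ [set: code] rel); first exact: finite_finset.
- move=> g [gn gW].
  have /choice[f fP] : forall i : 'I_(r * k ^ n), exists c : 'I_n.*2.+1 * 'I_(r * k ^ n.*2),
      nice g (n, i : nat) (val c.1, val c.2).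
    move=> i; have ps : kstd (n, i : nat) by rewrite /Defs.kstd /=.
    have [[m a] npq] := zlength_nice ps gn.
    have qn := zlength_range gn (erefl : (n, i : nat).1 = n) npq; have [_ qs _ _] := npq.
    have an : (a < r * k ^ n.*2)%N.
      by apply: leq_trans qs _; rewrite leq_mul2l leq_pexp2l ?orbT// ltnW.
    by exists (Ordinal (qn : (m < n.*2.+1)%N), Ordinal an).
  have /choice[a aP] : forall y : S, exists c : fset_set T, lab g (val y) = val c.
    move=> y; suff h : lab g (val y) \in fset_set T by exists [` h]%fset.
    rewrite in_fset_set ?inE//; exists (val y); first exact: valP.
    exists (untwist g (val y)); first exact: gW.
    by rewrite /untwist /= twK.
  by exists ([ffun i => f i], [ffun y => a y]) => //; split=> z /=; rewrite !ffunE; [exact: fP|exact: aP].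
- move=> g h [f a] [gn _] [hn _] [/= gf ga] [/= hf ha].
  have ht_eq : ht g = ht h.
    apply/val_inj/selfbij_ext => x.
    have [[m i] [/= mn ps px]] := kitv_ex hk x n; subst m.
    have [_ _ gaff _] := gf (Ordinal (ps : (i < r * k ^ n)%N)).
    have [_ _ haff _] := hf (Ordinal (ps : (i < r * k ^ n)%N)).
    by apply/val_inj; rewrite /= [LHS](gaff _ px) [RHS](haff _ px).
  have lab_eq : lab g =1 lab h.
    move=> y; have [yS|yS] := boolP (y \in S).
      by rewrite (ga [` yS]%fset) (ha [` yS]%fset).
    have out (l : G) : (zlength l <= n)%N -> lab l y = 1%g.
      by move=> ln; apply: contrapT => /(lab_supp ln)/SP; apply/negP.
    by rewrite !out.
  move: ht_eq lab_eq; rewrite /ht /lab; case: g {gf ga gn} => g1 g2; case: h {hf ha hn} => h1 h2 /= -> e.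
  by congr pair; exact: dsum_ext.
Qed.

Lemma approximable_wreath : approximable R Gamma -> approximable R G.
Proof.
move=> ap F e e0; have e42 : e / 4 + e / 4 < e by lra.
pose M := (\max_(g <- F) maxn (zlength g) #|` untwist_supp g|)%N.
(* At most [M] factors within [d] of 1 cost at most [e / 4] in each of the two functions; [M.+1]
   keeps the denominator nonzero, and [d <= 1/2] keeps [t] in [[0, 1]]. *)
pose d : R := Num.min (1 / 2) (e / (4 * M.+1%:R)).
have d0 : 0 < d.
  by rewrite lt_min; apply/andP; split; [lra|rewrite divr_gt0 ?mulr_gt0 ?ltr0n].
have d12 : d <= 1 / 2 by rewrite ge_min lexx.
have dM : d * M.+1%:R <= e / 4.
  have : d <= e / (4 * M.+1%:R) by rewrite ge_min lexx orbT.
  by rewrite ler_pdivlMr ?mulr_gt0// mulrCA [4 * _]mulrC -ler_pdivlMr.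
pose t := 1 - d.
have t01 : 0 <= t <= 1 by rewrite /t; apply/andP; split; lra.
have [kappa kP near] := twisted_kernel_ex theta ap
  (flatten [seq [seq untwist g x | x <- untwist_supp g] | g <- F]) d0.
exists (fun g => zipper_fun t g * wreath_fun kappa g); split.
- by apply: positive_definiteM; [exact: zipper_fun_pd|exact: wreath_fun_pd].
(* If the product is at least [eps] in modulus, so is each of the two functions. This gives
   [zlength g <= n] and places every [untwist g x] in one finite set, so [proper_fin] applies. *)
- move=> eps eps0; have [|n tn] := @expr_lt_ex R t eps _ eps0; first by rewrite /t; apply/andP; split; lra.
  have [_ _ _ van] := kP.
  apply: sub_finite_set (proper_fin n (van eps eps0)) => g /=.
  rewrite zipper_funE normrM ger0_norm ?ler0c ?exprn_ge0//; last by case/andP: t01.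
  have tz : 0 <= t ^+ zlength g <= 1.
    by case/andP: t01 => ? ?; rewrite exprn_ge0// exprn_ile1.
  move=> ge; split.
    rewrite leqNgt; apply/negP => /ltnW lt.
    suff : eps <= t ^+ n by rewrite leNgt tn.
    apply: le_trans (_ : t ^+ zlength g <= _); last first.
      by case/andP: t01 => ? ?; rewrite ler_wiXn2l.
    rewrite -lecR; apply: le_trans ge _; rewrite ler_piMr ?ler0c//.
      by case/andP: tz.
    exact: wreath_fun_le1 kP _.
  move=> x; apply: le_trans (wreath_fun_le kP g x); apply: le_trans ge _.
  by rewrite ler_piMl// lecR; case/andP: tz.
- have [_ diag _ _] := kP; rewrite zipper_funE /zlength /cells_sdiff setDv setU0 fset_set0.
  by rewrite cardfs0 expr0 mul1r /wreath_fun fsbig1// => x _; rewrite untwist1 diag.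
- move=> g gF.
  have gM : (maxn (zlength g) #|` untwist_supp g| <= M)%N by rewrite /M (big_rem g)//= leq_maxl.
  have zM : (zlength g <= M)%N by apply: leq_trans gM; rewrite leq_maxl.
  have uM : (#|` untwist_supp g| <= M)%N by apply: leq_trans gM; rewrite leq_maxr.
  have h1 : `|zipper_fun t g - 1| <= d%:C%C *+ M.
    have tE : `|t%:C%C - 1 : R[i]| = d%:C%C.
      rewrite /t rmorphB /= rmorph1 addrAC subrr add0r normrN ger0_norm// ler0c; exact: ltW.
    have t1 : `|t%:C%C : R[i]| <= 1.
      by case/andP: t01 => ? ?; rewrite ger0_norm ?ler0c// lecR.
    have := @prod_near1 R nat (iota 0 (zlength g)) (fun=> t%:C%C) d%:C%C (fun=> t1).
    rewrite big_const_seq count_predT size_iota -Monoid.iteropE /= zipper_funE rmorphXn /=.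
    move=> h; apply: le_trans (h _) _ => [i _|]; first by rewrite tE.
    by rewrite ler_wpMn2l ?ler0c ?ltW.
  have h2 : `|wreath_fun kappa g - 1| <= d%:C%C *+ M.
    apply: le_trans (wreath_fun_near1 kP (e := d%:C%C) _) _.
      move=> x xs; apply: near; apply/flattenP.
      exists [seq untwist g x | x <- untwist_supp g]; first by apply/mapP; exists g.
      by apply/mapP; exists x.
    by rewrite ler_wpMn2l ?ler0c ?ltW.
  rewrite (_ : _ - 1 = (zipper_fun t g - 1) * wreath_fun kappa g + (wreath_fun kappa g - 1)); last by ring.
  apply: le_lt_trans (ler_normD _ _) _.
  apply: le_lt_trans (_ : d%:C%C *+ M + d%:C%C *+ M < _).
    apply: lerD h2; rewrite normrM; apply: le_trans h1.
    by rewrite ler_piMr// wreath_fun_le1.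
  rewrite -(rmorphMn (real_complex R)) -rmorphD ltcR.
  have : d *+ M <= e / 4.
    by apply: le_trans dM; rewrite -(mulr_natr d M) ler_pM2l// ler_nat.
  by move=> u; apply: le_lt_trans (lerD u u) _.
Qed.
End Approximation.

Theorem corollary4 (R : realType) (Gamma : groupType) (theta : autG Gamma)
    (k r : nat) (hk : (2 <= k)%N) (hr : (1 <= r)%N) :
  haagerup R Gamma -> haagerup R (twisted_wreath R theta r hk).
Proof.
by move=> /haagerup_approximable/approximable_wreath h; apply/approximable_haagerup/h.
Qed.
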